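(* For every $c\in\mathbb C$, $(M_c,|0\rangle,T,Y(\cdot,z))$ and $(V_c,|0\rangle,T,Y(\cdot,z))$ are vertex algebras, where $M_c$ is the vacuum $\hat{\mathcal D}^+$-module of central charge $c$ and $V_c$ its irreducible quotient, $T=W^1_{-1}$, and $Y$ is the linear map determined by $$Y\big(W^{n_j}_{-k_j-n_j-1}\cdots W^{n_1}_{-k_1-n_1-1}|0\rangle,z\big)=\ :\partial_z^{(k_j)}W^{n_j}(z)\cdots\partial_z^{(k_1)}W^{n_1}(z):$$ for odd positive integers $n_i$ and integers $k_i\ge0$.
   Context: $\hat{\mathcal D}=\mathcal D\oplus\mathbb CC$, $\mathcal D$ spanned by $t^kf(D)$ ($k\in\mathbb Z$, $f\in\mathbb C[w]$, $D=t\partial_t$), $C$ central, $[t^rf(D),t^sg(D)]=t^{r+s}(f(D+s)g(D)-f(D)g(D+r))+\Psi\,C$, $\Psi$ antisymmetric, $\Psi=\sum_{-r\le j\le-1}f(j)g(j+r)$ if $r=-s\ge0$, $\Psi=0$ if $r+s\ne0$. $\hat{\mathcal D}^+$ is the subalgebra spanned by $C$ and $t^kg(D+(k+1)/2)$, $k\in\mathbb Z$, $g$ an odd polynomial. A basis of $\hat{\mathcal D}^+$ modulo $\mathbb CC$ is formed by $$W^n_k=-\tfrac12\big(t^{k+n}\partial_t^n+(-1)^{n+1}\partial_t^nt^{k+n}\big),\qquad k\in\mathbb Z,\ n\ge1\text{ odd}.$$ Put $W^n(z)=\sum_{k\in\mathbb Z}W^n_kz^{-k-n-1}$. The span $\mathcal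 P$ of the $W^n_k$ with $n$ odd and $n+k\ge0$ is a Lie subalgebra on which the cocycle $\Psi$ vanishes. $M_c$ is the $\hat{\mathcal D}^+$-module induced from the one-dimensional module of $\mathcal P\oplus\mathbb CC$ on which $\mathcal P$ acts by $0$ and $C$ by $c$; $|0\rangle$ is its generator (and its image in $V_c$). $\partial_z^{(k)}=\partial_z^k/k!$; the normal ordering $:\ :$ is the standard one, taken from right to left, moving annihilation operators (the $W^n_k\in\mathcal P$) to the right. *)

(* Defs.v *)
From HB Require Import structures.
From mathcomp Require Import all_boot all_order all_algebra finmap.
From mathcomp Require Import generic_quotient ring_quotient.
From mathcomp Require Import monalg ring.
From mathcomp Require Import boolp classical_sets functions fsbigop.

Set Implicit Arguments.
Unset Strict Implicit.
Unset Printing Implicit Defensive.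

Import Order.TTheory GRing.Theory Num.Theory.
Local Open Scope ring_scope.
Local Open Scope quotient_scope.

Section Span.
Variables (K : fieldType) (V : lmodType K).

Inductive in_span (S : V -> Prop) : V -> Prop :=
| in_span0 : in_span S 0
| in_spanZD a x y : S x -> in_span S y -> in_span S (a *: x + y).

Definition span (S : V -> Prop) : {pred V} := fun x => `[< in_span S x >].

Lemma spanP S x : reflect (in_span S x) (x \in span S).
Proof. exact: asboolP. Qed.

Lemma span_submod_closed S : submod_closed (span S).
Proof.
split=> [|a x y /spanP Sx /spanP Sy]; apply/spanP; first exact: in_span0.
elim: Sx => [|b {}x z Sx _ IH]; first by rewrite scaler0 add0r.
by rewrite scalerDr scalerA -addrA; apply: in_spanZD.
Qed.

HB.instance Definition _ S :=
  GRing.isSubmodClosed.Build K V (span S) (span_submod_closed S).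

Lemma mem_span (S : V -> Prop) x : S x -> x \in span S.
Proof.
by move=> Sx; apply/spanP; rewrite -[x]addr0 -[x]scale1r; apply: in_spanZD (in_span0 _).
Qed.

Lemma span_sub (S : V -> Prop) (W : submodClosed V) :
  (forall x, S x -> x \in W) -> {subset span S <= W}.
Proof.
move=> SW x /spanP; elim=> [|a {}x y Sx _ Wy]; first exact: rpred0.
by apply: rpredD => //; apply/rpredZ/SW.
Qed.
End Span.

(* The library provides the quotient of an additive group; this adds the
   scalar multiplication. *)
Section QuotientModule.
Variables (K : fieldType) (V : lmodType K) (S : V -> Prop).

Definition lquot := Quotient.quot (span S).
HB.instance Definition _ := GRing.Zmodule.on lquot.

Definition lproj (x : V) : lquot := \pi_(Quotient.quot (span S)) x.
Definition lrepr (x : lquot) : V := repr (x : Quotient.quot (span S)).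

Lemma lprojP x y : (lproj x = lproj y) <-> (x - y \in span S).
Proof. by rewrite Quotient.idealrBE; split=> [/eqP|/eqP]. Qed.

Lemma lreprK : cancel lrepr lproj.
Proof. exact: reprK. Qed.

Lemma lprojD : {morph lproj : x y / x + y}.
Proof. by move=> x y; rewrite /lproj [LHS]raddfD. Qed.

Definition lscale (a : K) (x : lquot) : lquot := lproj (a *: lrepr x).

Lemma lprojZ a x : lproj (a *: x) = lscale a (lproj x).
Proof.
by apply/lprojP; rewrite -scalerBr; apply/rpredZ/lprojP; rewrite lreprK.
Qed.

Fact lscaleA a b x : lscale a (lscale b x) = lscale (a * b) x.
Proof. by rewrite -[x]lreprK -!lprojZ scalerA. Qed.
Fact lscale1 : left_id 1 lscale.
Proof. by move=> x; rewrite -[x]lreprK -!lprojZ scale1r. Qed.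
Fact lscaleDr : right_distributive lscale +%R.
Proof.
by move=> a x y; rewrite -[x]lreprK -[y]lreprK -lprojD -!lprojZ -lprojD scalerDr.
Qed.
Fact lscaleDl x : {morph lscale^~ x : a b / a + b}.
Proof. by move=> a b; rewrite -[x]lreprK -!lprojZ -lprojD scalerDl. Qed.

HB.instance Definition _ :=
  GRing.Zmodule_isLmodule.Build K lquot lscaleA lscale1 lscaleDr lscaleDl.

Fact lproj_is_linear : linear lproj.
Proof. by move=> a x y; rewrite lprojD lprojZ. Qed.
HB.instance Definition _ := GRing.isLinear.Build K V lquot _ lproj lproj_is_linear.
End QuotientModule.

Section LieModule.
Variables (K : fieldType) (g : lmodType K) (br : g -> g -> g).

Definition lie_module (V : lmodType K) (rho : g -> V -> V) : Prop :=
  [/\ forall v, linear (rho^~ v),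
      forall x, linear (rho x)
    & forall x y v, rho (br x y) v = rho x (rho y v) - rho y (rho x v)].

Definition lie_module_hom (V V' : lmodType K) (rho : g -> V -> V)
    (rho' : g -> V' -> V') (f : V -> V') : Prop :=
  linear f /\ forall x v, f (rho x v) = rho' x (f v).

Definition lie_irreducible (V : lmodType K) (rho : g -> V -> V) : Prop :=
  (exists v : V, v != 0) /\
  forall U : submodClosed V, (forall x u, u \in U -> rho x u \in U) ->
    (forall u, u \in U -> u = 0) \/ (forall u, u \in U).

Definition irreducible_quotient (M V : lmodType K) (rhoM : g -> M -> M)
    (rhoV : g -> V -> V) (f : M -> V) : Prop :=
  [/\ lie_module rhoV, lie_irreducible rhoV, lie_module_hom rhoM rhoV f
    & forall v, exists u, f u = v].

(* The module induced from a character [chi] of a subalgebra [p]: the tensor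
   algebra of [g] modulo the relations x y - y x = [x, y] of the enveloping
   algebra and the left ideal generated by x - chi x, x in [p].  The word
   x_1 ... x_n stands for the vector x_1 (... (x_n |0>)). *)
Variables (p : g -> Prop) (chi : g -> K).

Definition word (s : seq g) : {malg K[seq g]} := << s >>.

Inductive ind_rel : {malg K[seq g]} -> Prop :=
| ind_rel_linear u v a x y :
    ind_rel (word (u ++ (a *: x + y) :: v)
             - (a *: word (u ++ x :: v) + word (u ++ y :: v)))
| ind_rel_bracket u v x y :
    ind_rel (word (u ++ br x y :: v)
             - (word (u ++ x :: y :: v) - word (u ++ y :: x :: v)))
| ind_rel_char u x : p x ->
    ind_rel (word (rcons u x) - chi x *: word u).

Definition induced : lmodType K := lquot ind_rel.
Definition ind_gen : induced := lproj ind_rel (word [::]).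

Definition lmul_word (x : g) (m : {malg K[seq g]}) : {malg K[seq g]} :=
  \sum_(s <- msupp m) m@_s *: word (x :: s).
Definition ind_act (x : g) (v : induced) : induced :=
  lproj ind_rel (lmul_word x (lrepr v)).

Lemma lmul_wordEw x m (d : {fset seq g}) : (msupp m `<=` d)%fset ->
  lmul_word x m = \sum_(s <- d) m@_s *: word (x :: s).
Proof.
move=> md; rewrite /lmul_word (big_fset_incl _ md) // => s _ /mcoeff_outdom ->.
by rewrite scale0r.
Qed.

Fact lmul_word_is_linear x : linear (lmul_word x).
Proof.
move=> a m n; set d := (msupp m `|` msupp n)%fset.
have dm : (msupp m `<=` d)%fset by apply: fsubsetUl.
have dn : (msupp n `<=` d)%fset by apply: fsubsetUr.
have dmn : (msupp (a *: m + n) `<=` d)%fset.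
  apply: fsubset_trans (msuppD_le _ _) _; rewrite fsubUset dn andbT.
  exact: fsubset_trans (msuppZ_le _ _) dm.
rewrite (lmul_wordEw _ dm) (lmul_wordEw _ dn) (lmul_wordEw _ dmn).
rewrite scaler_sumr -big_split; apply: eq_bigr => s _.
by rewrite mcoeffD mcoeffZ scalerDl scalerA.
Qed.
HB.instance Definition _ x :=
  GRing.isLinear.Build K _ _ _ (lmul_word x) (lmul_word_is_linear x).

Lemma lmul_wordE x s : lmul_word x (word s) = word (x :: s).
Proof. by rewrite (lmul_wordEw _ msuppU_le) big_seq_fset1 mcoeffUU scale1r. Qed.

Lemma lmul_word_rel x m : ind_rel m -> ind_rel (lmul_word x m).
Proof.
case=> [u v a y z|u v y z|u y py].
- rewrite linearB linearP /= !lmul_wordE; exact: (ind_rel_linear (x :: u)).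
- rewrite !linearB /= -opprD !lmul_wordE; exact: (ind_rel_bracket (x :: u)).
- rewrite linearB linearZ /= !lmul_wordE; exact: (ind_rel_char (x :: u)).
Qed.

Lemma lmul_word_span x m : m \in span ind_rel -> lmul_word x m \in span ind_rel.
Proof.
move=> /spanP; elim=> [|a {}m n rm _ IH]; first by rewrite linear0 rpred0.
rewrite linearP; apply: rpredD => //.
by apply/rpredZ/mem_span/lmul_word_rel.
Qed.

Lemma ind_actE x m :
  ind_act x (lproj ind_rel m) = lproj ind_rel (lmul_word x m).
Proof.
by apply/lprojP; rewrite -linearB; apply/lmul_word_span/lprojP; rewrite lreprK.
Qed.

Lemma malg_ext (V : lmodType K) (f h : {linear {malg K[seq g]} -> V}) :
  (forall s, f (word s) = h (word s)) -> f =1 h.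
Proof.
move=> fh m; rewrite [m]monalgE !linear_sum; apply: eq_bigr => s _.
have -> : << m@_s *g s >> = m@_s *: word s.
  by apply/malgP=> t; rewrite mcoeffZ !mcoeffU mulr_natr.
by rewrite !linearZ fh.
Qed.

Fact ind_act_linear x : linear (ind_act x).
Proof.
by move=> a v w; rewrite -[v]lreprK -[w]lreprK -linearP !ind_actE !linearP.
Qed.

Lemma ind_lie_module : lie_module ind_act.
Proof.
split=> [v a x y||x y v]; last 2 first.
- exact: ind_act_linear.
- rewrite -[v]lreprK !ind_actE -linearB.
  pose f : {linear _ -> _} := lproj ind_rel \o lmul_word (br x y).
  pose h : {linear _ -> _} := lproj ind_rel \o
    ((lmul_word x \o lmul_word y) \- (lmul_word y \o lmul_word x)).
  apply: (@malg_ext _ f h) => s /=; rewrite !lmul_wordE.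
  by apply/lprojP/mem_span/(@ind_rel_bracket [::] s).
- rewrite -[v]lreprK !ind_actE -linearP.
  pose f : {linear _ -> _} := lproj ind_rel \o lmul_word (a *: x + y).
  pose h : {linear _ -> _} := lproj ind_rel \o
    ((a \*: lmul_word x) \+ lmul_word y).
  apply: (@malg_ext _ f h) => s /=; rewrite !lmul_wordE.
  by apply/lprojP/mem_span/(@ind_rel_linear [::] s).
Qed.

Lemma ind_act_gen x : p x -> ind_act x ind_gen = chi x *: ind_gen.
Proof.
move=> px; rewrite /ind_gen ind_actE lmul_wordE -linearZ.
by apply/lprojP/mem_span/(@ind_rel_char [::]).
Qed.

Lemma ind_universal (V : lmodType K) (rho : g -> V -> V) (v0 : V) :
  lie_module rho -> (forall x, p x -> rho x v0 = chi x *: v0) ->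
  exists! f : induced -> V, lie_module_hom ind_act rho f /\ f ind_gen = v0.
Proof.
move=> [rl rr rb] rp.
pose ev (s : seq g) := foldr rho v0 s.
pose F (m : {malg K[seq g]}) := \sum_(s <- msupp m) m@_s *: ev s.
have FEw m (d : {fset seq g}) : (msupp m `<=` d)%fset ->
    F m = \sum_(s <- d) m@_s *: ev s.
  move=> md; rewrite /F (big_fset_incl _ md) // => s _ /mcoeff_outdom ->.
  by rewrite scale0r.
have Fl : linear F.
  move=> a m n; set d := (msupp m `|` msupp n)%fset.
  have dm : (msupp m `<=` d)%fset by apply: fsubsetUl.
  have dn : (msupp n `<=` d)%fset by apply: fsubsetUr.
  have dmn : (msupp (a *: m + n) `<=` d)%fset.
    apply: fsubset_trans (msuppD_le _ _) _; rewrite fsubUset dn andbT.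
    exact: fsubset_trans (msuppZ_le _ _) dm.
  rewrite (FEw _ _ dm) (FEw _ _ dn) (FEw _ _ dmn).
  rewrite scaler_sumr -big_split; apply: eq_bigr => s _.
  by rewrite mcoeffD mcoeffZ scalerDl scalerA.
pose FL : {linear _ -> V} := HB.pack F (GRing.isLinear.Build _ _ _ _ F Fl).
have Fw s : FL (word s) = ev s.
  by rewrite /= (FEw _ _ msuppU_le) big_seq_fset1 mcoeffUU scale1r.
pose R x : {linear V -> V} :=
  HB.pack (rho x) (GRing.isLinear.Build _ _ _ _ (rho x) (rr x)).
have Fr m : m \in span ind_rel -> FL m = 0.
  move=> /spanP; elim=> [|a {}m n rm _ IH]; first exact: linear0.
  rewrite linearP IH addr0; suff -> : FL m = 0 by rewrite scaler0.
  case: rm => [u v b x y|u v x y|u x px].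
  - rewrite linearB linearP !Fw.
    apply/eqP; rewrite subr_eq0; apply/eqP; elim: u => [|z u IHu] /=; first exact: rl.
    by rewrite IHu rr.
  - rewrite !linearB -opprD !Fw.
    apply/eqP; rewrite subr_eq0; apply/eqP; elim: u => [|z u IHu] /=; first exact: rb.
    by rewrite IHu; apply: (linearB (R z)).
  - rewrite linearB linearZ !Fw -cats1.
    apply/eqP; rewrite subr_eq0; apply/eqP; elim: u => [|z u IHu] /=; first exact: rp.
    by rewrite IHu; apply: (linearZ_LR (R z)).
have Fq m n : lproj ind_rel m = lproj ind_rel n -> FL m = FL n.
  by move=> /lprojP/Fr; rewrite linearB => /eqP; rewrite subr_eq0 => /eqP.
exists (fun v => FL (lrepr v)); split; first split; first split.
- move=> a v w; rewrite -[RHS]/(a *: FL _ + FL _) -linearP; apply: Fq.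
  by rewrite lreprK linearP /= !lreprK.
- move=> x v; rewrite -[v in LHS]lreprK ind_actE.
  rewrite (Fq _ (lmul_word x (lrepr v))) ?lreprK //.
  pose f : {linear _ -> _} := FL \o lmul_word x.
  pose h : {linear _ -> _} := R x \o FL.
  apply: (@malg_ext _ f h) => s.
  by rewrite -[LHS]/(FL (lmul_word x (word s))) -[RHS]/(R x (FL (word s))) lmul_wordE !Fw.
- by rewrite (Fq _ (word [::])) ?lreprK ?Fw.
move=> h [[lh hh] h0]; apply/funext => v; rewrite -[in RHS](lreprK v).
pose H : {linear _ -> V} := HB.pack h (GRing.isLinear.Build _ _ _ _ h lh).
apply: (@malg_ext _ FL (H \o lproj ind_rel)) => s.
rewrite Fw -[RHS]/(h (lproj ind_rel (word s))).
elim: s => [|x s IHs]; first exact: esym h0.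
by rewrite -lmul_wordE -ind_actE hh -IHs.
Qed.
End LieModule.

Section DifferentialOperators.
Variable K : numFieldType.

(* Differential operators on the circle: the coefficient at k : int is the
   polynomial f of the term t^k f(D). *)
Definition Dop := {malg {poly K}[int]}.
HB.instance Definition _ := GRing.Zmodule.on Dop.

Definition Dop_scale (a : K) (x : Dop) : Dop :=
  (a%:P : {poly K}) *: (x : {malg {poly K}[int]}).

Fact Dop_scaleA a b x : Dop_scale a (Dop_scale b x) = Dop_scale (a * b) x.
Proof. by rewrite /Dop_scale scalerA polyCM. Qed.
Fact Dop_scale1 : left_id 1 Dop_scale.
Proof. by move=> x; rewrite /Dop_scale scale1r. Qed.
Fact Dop_scaleDr : right_distributive Dop_scale +%R.
Proof. by move=> a x y; rewrite /Dop_scale scalerDr. Qed.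
Fact Dop_scaleDl x : {morph Dop_scale^~ x : a b / a + b}.
Proof. by move=> a b; rewrite /Dop_scale polyCD scalerDl. Qed.
HB.instance Definition _ := GRing.Zmodule_isLmodule.Build K Dop
  Dop_scaleA Dop_scale1 Dop_scaleDr Dop_scaleDl.

Definition tD (k : int) (f : {poly K}) : Dop := << f *g k >>.

Lemma DopZE a (x : Dop) k : (a *: x)@_k = a *: x@_k.
Proof. by rewrite -[LHS]/((a%:P *: (x : {malg {poly K}[int]}))@_k) mcoeffZ mul_polyC. Qed.

Fact tD_is_linear k : linear (tD k).
Proof.
move=> a f g; apply/malgP=> l.
by rewrite mcoeffD DopZE !mcoeffU; case: eqP; rewrite // scaler0 addr0.
Qed.
HB.instance Definition _ k :=
  GRing.isLinear.Build K {poly K} Dop _ (tD k) (tD_is_linear k).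

Section LinearExtension.
Variable U : lmodType K.

Definition Dlift (G : int -> {poly K} -> U) (x : Dop) : U :=
  \sum_(r <- msupp x) G r x@_r.

Definition Dlift2 (F : int -> {poly K} -> int -> {poly K} -> U) (x y : Dop) : U :=
  Dlift (fun r f => Dlift (fun s g => F r f s g) y) x.

Variable G : int -> {poly K} -> U.
Hypothesis Glin : forall r, linear (G r).

Let G0 r : G r 0 = 0.
Proof.
have := Glin r 1 0 0; rewrite !scale1r !addr0 => /eqP.
by rewrite -[X in X == _]addr0 (inj_eq (addrI _)) eq_sym => /eqP.
Qed.

Lemma DliftEw x (d : {fset int}) : (msupp x `<=` d)%fset ->
  Dlift G x = \sum_(r <- d) G r x@_r.
Proof.
by move=> xd; rewrite /Dlift (big_fset_incl _ xd) // => r _ /mcoeff_outdom ->.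
Qed.

Lemma Dlift_tD r f : Dlift G (tD r f) = G r f.
Proof. by rewrite (DliftEw msuppU_le) big_seq_fset1 mcoeffUU. Qed.

Lemma Dlift_linear : linear (Dlift G).
Proof.
move=> a x y; set d := (msupp x `|` msupp y)%fset.
have dx : (msupp x `<=` d)%fset by apply: fsubsetUl.
have dy : (msupp y `<=` d)%fset by apply: fsubsetUr.
have dxy : (msupp (a *: x + y) `<=` d)%fset.
  apply: fsubset_trans (msuppD_le _ _) _; rewrite fsubUset dy andbT.
  by apply: fsubset_trans (msuppZ_le _ _) dx.
rewrite (DliftEw dx) (DliftEw dy) (DliftEw dxy) scaler_sumr -big_split.
by apply: eq_bigr => r _; rewrite mcoeffD DopZE Glin.
Qed.
End LinearExtension.

Section BilinearExtension.
Variables (U : lmodType K) (F : int -> {poly K} -> int -> {poly K} -> U).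
Hypothesis Fl : forall r s g, linear (fun f => F r f s g).
Hypothesis Fr : forall r f s, linear (F r f s).

Lemma Dlift2_tD r f s g : Dlift2 F (tD r f) (tD s g) = F r f s g.
Proof.
rewrite /Dlift2 Dlift_tD; first by rewrite Dlift_tD.
move=> q a f1 f2; rewrite /Dlift scaler_sumr -big_split.
by apply: eq_bigr => i _; apply: Fl.
Qed.

Lemma Dlift2_linearl y : linear (Dlift2 F ^~ y).
Proof.
apply: Dlift_linear => q a f1 f2; rewrite /Dlift scaler_sumr -big_split.
by apply: eq_bigr => i _; apply: Fl.
Qed.

Lemma Dlift2_linearr x : linear (Dlift2 F x).
Proof.
move=> a y z; rewrite /Dlift2 {1 3 4}/Dlift scaler_sumr -big_split.
by apply: eq_bigr => i _; apply: Dlift_linear.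
Qed.
End BilinearExtension.

Definition shift (a : K) (f : {poly K}) : {poly K} := f \Po ('X + a%:P).

Fact shift_is_linear a : linear (shift a).
Proof. by move=> b f g; rewrite /shift comp_polyD comp_polyZ. Qed.
HB.instance Definition _ a :=
  GRing.isLinear.Build K _ _ _ (shift a) (shift_is_linear a).

(* composition of operators: D t^s = t^s (D + s) *)
Definition Dmul : Dop -> Dop -> Dop :=
  Dlift2 (fun r f s g => tD (r + s) (shift s%:~R f * g)).

Definition Dbracket : Dop -> Dop -> Dop :=
  Dlift2 (fun r f s g =>
    tD (r + s) (shift s%:~R f * g - f * shift r%:~R g)).

(* the sum of f(j) g(j+m) over -m <= j <= -1, reindexed by i = j + m *)
Definition Psi_sum (m : nat) (f g : {poly K}) : K :=
  \sum_(i < m) f.[i%:R - m%:R] * g.[i%:R].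

Definition Psi_mono (r : int) (f : {poly K}) (s : int) (g : {poly K}) : K^o :=
  if r + s == 0 then
    match r with
    | Posz m => Psi_sum m f g
    | Negz m => - Psi_sum m.+1 g f
    end
  else 0.

Definition Psi : Dop -> Dop -> K^o := Dlift2 Psi_mono.

(* the second component is the coefficient of the central element C *)
Definition Dhat : lmodType K := (Dop * K^o)%type.

Definition Dhat_bracket (x y : Dhat) : Dhat := (Dbracket x.1 y.1, Psi x.1 y.1).

Definition Dhat_op (x : Dop) : Dhat := (x, 0).
Definition Dhat_C : Dhat := (0, 1).

Definition oddp (g : {poly K}) : Prop := g \Po (- 'X) = - g.

Inductive Dplus_gen : Dhat -> Prop :=
| Dplus_gen_C : Dplus_gen Dhat_C
| Dplus_gen_t k g : oddp g ->
    Dplus_gen (Dhat_op (tD k (shift ((k%:~R + 1) / 2) g))).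

Record Dplus := MkDplus { Dplus_val : Dhat; _ : Dplus_val \in span Dplus_gen }.
HB.instance Definition _ := [isSub for Dplus_val].
HB.instance Definition _ := [Choice of Dplus by <:].
HB.instance Definition _ := [SubChoice_isSubLmodule of Dplus by <:].

Fact Psi_mono_linearl r s g : linear (fun f => Psi_mono r f s g).
Proof.
move=> a f h; rewrite /Psi_mono; case: (r + s == 0); last by rewrite scaler0 addr0.
case: r => m; rewrite /Psi_sum ?scalerN -?opprD scaler_sumr -big_split.
  by apply: eq_bigr => i _; rewrite hornerD hornerZ mulrDl -mulrA.
congr (- _); apply: eq_bigr => i _.
by rewrite hornerD hornerZ mulrDr mulrCA.
Qed.

Fact Psi_mono_linearr r f s : linear (Psi_mono r f s).
Proof.
move=> a g h; rewrite /Psi_mono; case: (r + s == 0); last by rewrite scaler0 addr0.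
case: r => m; rewrite /Psi_sum ?scalerN -?opprD scaler_sumr -big_split.
  by apply: eq_bigr => i _; rewrite hornerD hornerZ mulrDr mulrCA.
congr (- _); apply: eq_bigr => i _.
by rewrite hornerD hornerZ mulrDl -mulrA.
Qed.

Lemma Psi_tD r f s g : Psi (tD r f) (tD s g) = Psi_mono r f s g.
Proof.
by apply: Dlift2_tD => *; [apply: Psi_mono_linearl | apply: Psi_mono_linearr].
Qed.

Lemma Dmul_tD r f s g :
  Dmul (tD r f) (tD s g) = tD (r + s) (shift s%:~R f * g).
Proof.
rewrite /Dmul Dlift2_tD // => [q u h a f1 f2|q f1 u a g1 g2].
  by rewrite linearP mulrDl -scalerAl linearP.
by rewrite mulrDr -scalerAr linearP.
Qed.

Let Dbr r f s g := tD (r + s) (shift s%:~R f * g - f * shift r%:~R g).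
Let Dbr_linearl r s g : linear (fun f => Dbr r f s g).
Proof.
move=> a f1 f2; rewrite /Dbr linearP !mulrDl -!scalerAl opprD addrACA.
by rewrite -scalerBr linearP.
Qed.
Let Dbr_linearr r f s : linear (Dbr r f s).
Proof.
move=> a f1 f2; rewrite /Dbr linearP !mulrDr -!scalerAr opprD addrACA.
by rewrite -scalerBr linearP.
Qed.

Lemma Dbracket_tD r f s g : Dbracket (tD r f) (tD s g) =
  tD (r + s) (shift s%:~R f * g - f * shift r%:~R g).
Proof. by rewrite /Dbracket Dlift2_tD. Qed.

Lemma Dhat_bracket_linearl y : linear (Dhat_bracket ^~ y).
Proof.
move=> a x x'; rewrite /Dhat_bracket; congr (_, _).
  exact: (Dlift2_linearl Dbr_linearl).
exact: (Dlift2_linearl Psi_mono_linearl).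
Qed.

Lemma Dhat_bracket_linearr x : linear (Dhat_bracket x).
Proof.
move=> a y y'; rewrite /Dhat_bracket; congr (_, _).
  exact: (Dlift2_linearr Dbr_linearr).
exact: (Dlift2_linearr Psi_mono_linearr).
Qed.

Lemma shiftM a f g : shift a (f * g) = shift a f * shift a g.
Proof. exact: comp_polyM. Qed.

Lemma shiftA a b f : shift a (shift b f) = shift (a + b) f.
Proof.
by rewrite /shift -comp_polyA comp_polyD comp_polyX comp_polyC polyCD addrA.
Qed.

Lemma shift_oddp a f : oddp f -> shift a f \Po (- 'X) = - shift (- a) f.
Proof.
move=> fo; rewrite /shift.
have cN (p q : {poly K}) : (- p) \Po q = - (p \Po q) by apply: linearN.
rewrite -cN -fo -!comp_polyA cN !comp_polyD !comp_polyX !comp_polyC.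
by rewrite opprD polyCN opprK.
Qed.

Lemma bracket_oddp (r s : int) a b : oddp a -> oddp b ->
  oddp (shift (s%:~R / 2) a * shift (- (r%:~R / 2)) b
        - shift (- (s%:~R / 2)) a * shift (r%:~R / 2) b).
Proof.
move=> ao bo; rewrite /oddp comp_polyB !comp_polyM !shift_oddp // !opprK.
by rewrite !mulrNN opprB.
Qed.

Lemma Dhat_bracketCl y : Dhat_bracket Dhat_C y = 0.
Proof.
have -> : Dhat_C = (0, 1) :> Dhat by [].
by rewrite /Dhat_bracket /Dbracket /Psi /Dlift2 /Dlift msupp0 !big_seq_fset0.
Qed.

Lemma Dhat_bracketCr x : Dhat_bracket x Dhat_C = 0.
Proof.
rewrite /Dhat_bracket /Dbracket /Psi /Dlift2 /Dlift /= msupp0.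
by congr (_, _); apply: big1 => r _; rewrite big_seq_fset0.
Qed.

Lemma Dhat_bracket_Dplus x y : x \in span Dplus_gen -> y \in span Dplus_gen ->
  Dhat_bracket x y \in span Dplus_gen.
Proof.
move=> + /spanP Sy => /spanP; elim=> [|a {}x x' gx _ IH].
  suff -> : Dhat_bracket 0 y = 0 by rewrite rpred0.
  by rewrite /Dhat_bracket /Dbracket /Psi /Dlift2 /Dlift msupp0 !big_seq_fset0.
rewrite Dhat_bracket_linearl; apply: rpredD IH; apply: rpredZ.
elim: Sy => [|b {}y y' gy _ IH].
  suff -> : Dhat_bracket x 0 = 0 by rewrite rpred0.
  rewrite /Dhat_bracket /Dbracket /Psi /Dlift2 /Dlift /= msupp0.
  by congr (_, _); apply: big1 => r _; rewrite big_seq_fset0.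
rewrite Dhat_bracket_linearr; apply: rpredD IH; apply: rpredZ.
case: gx => [|k f fo]; first by rewrite Dhat_bracketCl rpred0.
case: gy => [|l h ho]; first by rewrite Dhat_bracketCr rpred0.
rewrite /Dhat_bracket /= Dbracket_tD.
set z := Psi _ _.
have -> u : (u, z) = z *: Dhat_C + Dhat_op u.
  by congr (_, _); rewrite /= ?scaler0 ?add0r ?addr0 // -[RHS]/(z * 1) mulr1.
apply: rpredD; first by apply/rpredZ/mem_span; constructor.
have -> : shift l%:~R (shift ((k%:~R + 1) / 2) f) * shift ((l%:~R + 1) / 2) h
   - shift ((k%:~R + 1) / 2) f * shift k%:~R (shift ((l%:~R + 1) / 2) h)
  = shift (((k + l)%:~R + 1) / 2)
     (shift (l%:~R / 2) f * shift (- (k%:~R / 2)) h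
        - shift (- (l%:~R / 2)) f * shift (k%:~R / 2) h).
  rewrite [RHS]linearB /= !shiftM !shiftA rmorphD /=.
  congr (shift _ _ * shift _ _ - shift _ _ * shift _ _); by field.
by apply/mem_span/Dplus_gen_t/bracket_oddp.
Qed.

Definition tpow (m : int) : Dop := tD m 1.
Definition dt : Dop := tD (-1) 'X.
Definition dt_pow (n : nat) : Dop := iter n (Dmul dt) (tD 0 1).

Definition W_op (n : nat) (k : int) : Dop :=
  - 2^-1 *: (Dmul (tpow (k + n%:Z)) (dt_pow n)
             + (-1) ^+ n.+1 *: Dmul (dt_pow n) (tpow (k + n%:Z))).

Lemma dt_powE n :
  dt_pow n = tD (- n%:Z) (\prod_(i < n) ('X - (i%:R)%:P)).
Proof.
elim: n => [|n IH]; first by rewrite big_ord0.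
rewrite /dt_pow iterS -/(dt_pow n) IH Dmul_tD big_ord_recr /= mulrC.
congr (tD _ (_ * _)); first by rewrite -opprD -addn1 PoszD addrC.
by rewrite /shift comp_polyX rmorphN /= polyCN.
Qed.

Lemma W_op_Dplus n k : Dhat_op (W_op n k) \in span Dplus_gen.
Proof.
set P := \prod_(i < n) ('X - (i%:R)%:P) : {poly K}.
pose h : K := (k%:~R + 1) / 2; pose A := shift (- h) P.
have shift1 a : shift a 1 = 1 by rewrite /shift comp_polyC.
have -> : W_op n k = tD k (shift h (- 2^-1 *: (A - (A \Po (- 'X))))).
  have e1 : k + n%:Z + - n%:Z = k by rewrite addrK.
  have e2 : - n%:Z + (k + n%:Z) = k by rewrite addrC addrK.
  rewrite /W_op dt_powE !Dmul_tD shift1 mul1r mulr1 e1 e2.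
  have tZ a f : a *: tD k f = tD k (a *: f) by rewrite linearZ.
  rewrite tZ -linearD tZ; congr (tD k _) => /=.
  have sA : shift h A = P by rewrite /A shiftA subrr /shift addr0 comp_polyXr.
  have shB f g : shift h (f - g) = shift h f - shift h g by apply: comp_polyB.
  have shZ a f : shift h (a *: f) = a *: shift h f by apply: comp_polyZ.
  rewrite shZ shB sA -/P; congr (_ *: (_ + _)).
  suff -> : shift (k + n%:Z)%:~R P = (-1) ^+ n *: shift h (A \Po (- 'X)).
    by rewrite scalerA exprS -mulrA -exprMn mulrNN mulr1 expr1n mulr1 scaleN1r.
  have compB (a b : K) : ('X - a%:P) \Po ('X + b%:P) = 'X + (b - a)%:P.
    by rewrite comp_polyB comp_polyX comp_polyC polyCB addrA.
  rewrite /A /shift -!comp_polyA /P.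
  rewrite !(rmorph_prod (comp_poly _)) /=.
  have -> : (-1) ^+ n = \prod_(i < n) (-1) :> K by rewrite prodr_const card_ord.
  rewrite -scaler_prod [LHS](reindex_inj rev_ord_inj) /=.
  apply: eq_bigr => i _; rewrite compB scaleN1r.
  have cN (p q : {poly K}) : (- p) \Po q = - (p \Po q) by apply: linearN.
  rewrite comp_polyB !comp_polyD !cN !comp_polyX !comp_polyC natrB // intrD.
  rewrite -[LHS]opprK; congr (- _).
  have -> : (k%:~R + n%:~R - (n%:R - i.+1%:R)) = h + h + i%:R.
    by rewrite /h -addn1 natrD; field.
  by rewrite !polyCD polyCN !opprD !addrA -!addrA; do ?congr (_ + _); rewrite addrC.
apply/mem_span/Dplus_gen_t.
have cN (p q : {poly K}) : (- p) \Po q = - (p \Po q) by apply: linearN.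
rewrite /oddp comp_polyZ comp_polyB -(comp_polyA A) cN comp_polyX opprK comp_polyXr.
by rewrite -scalerN opprB.
Qed.
End DifferentialOperators.

Section VacuumModule.
Variable K : numFieldType.

Definition Dplus_C : Dplus K := MkDplus (mem_span (Dplus_gen_C K)).

Definition Dplus_bracket (x y : Dplus K) : Dplus K :=
  MkDplus (Dhat_bracket_Dplus (valP x) (valP y)).

Definition W (n : nat) (k : int) : Dplus K := MkDplus (W_op_Dplus K n k).

Inductive PC_gen : Dplus K -> Prop :=
| PC_gen_C : PC_gen Dplus_C
| PC_gen_W n k : odd n -> 0 <= n%:Z + k -> PC_gen (W n k).

(* P + K C, with the character that kills P (whose elements have no component
   along C) and takes the value c at C *)
Definition PC (x : Dplus K) : Prop := x \in span PC_gen.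
Definition PC_char (c : K) (x : Dplus K) : K := c * (Dplus_val x).2.

Definition Mc (c : K) : lmodType K := induced Dplus_bracket PC (PC_char c).
Definition Mc_act (c : K) : Dplus K -> Mc c -> Mc c :=
  ind_act (br := Dplus_bracket) (p := PC) (chi := PC_char c).
Definition Mc_vac (c : K) : Mc c := ind_gen Dplus_bracket PC (PC_char c).
End VacuumModule.

Arguments W {K} n k.
Arguments Dplus_bracket {K} x y.
Arguments Mc_act {K} c x v.
Arguments Mc_vac {K} c.

(* A formal distribution A(z) with coefficients in End V is given by its
   coefficients: [A m] is the coefficient of z^m. *)
Section FormalDistributions.
Variables (K : numFieldType) (V : lmodType K).

Definition distr := int -> V -> V.
Implicit Types A B : distr.

Definition is_field A : Prop :=
  forall v, exists N : int, forall m, m < N -> A m v = 0.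

Definition distr_id : distr := fun m v => if m == 0 then v else 0.

Definition distr_deriv A : distr := fun m v => (m + 1)%:~R *: A (m + 1) v.

Definition distr_divderiv (k : nat) A : distr :=
  fun m v => (k`!%:R)^-1 *: iter k distr_deriv A m v.

(* :A(z)B(z): = A(z)_+ B(z) + B(z) A(z)_-, where A(z)_- is the part of A(z)
   with negative powers of z.  Both sums are finite if A and B are fields. *)
Definition nprod A B : distr := fun N v =>
  \sum_(m \in [set m : int | 0 <= m]%classic) A m (B (N - m) v)
  + \sum_(m \in [set m : int | m < 0]%classic) B (N - m) (A m v).

(* In two variables, [F m n] is the coefficient of z^m w^n; [mul_zw] multiplies
   by z - w. *)
Definition distr_comm A B (m n : int) (v : V) : V := A m (B n v) - B n (A m v).

Definition mul_zw (F : int -> int -> V -> V) (m n : int) (v : V) : V :=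
  F (m - 1) n v - F m (n - 1) v.

Definition mutually_local A B : Prop :=
  exists N : nat, forall m n v, iter N mul_zw (distr_comm A B) m n v = 0.

Record vertex_algebra (vac : V) (T : V -> V) (Y : V -> distr) : Prop := {
  va_linear : linear Y;
  va_endo : forall a m, linear (Y a m);
  va_field : forall a, is_field (Y a);
  va_transl_linear : linear T;
  va_transl_vac : T vac = 0;
  va_transl : forall a m v, T (Y a m v) - Y a m (T v) = distr_deriv (Y a) m v;
  va_vac : Y vac = distr_id;
  va_create : forall a, (forall m, m < 0 -> Y a m vac = 0) /\ Y a 0 vac = a;
  va_local : forall a b, mutually_local (Y a) (Y b)
}.

Variable rho : Dplus K -> V -> V.

(* W^n(z) = sum_k W^n_k z^(- k - n - 1) *)
Definition W_field (n : nat) : distr := fun m v => rho (W n (- m - n%:Z - 1)) v.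

(* The sequence [:: (n_j, k_j); ...; (n_1, k_1)] encodes the vector
   W^(n_j)_(- k_j - n_j - 1) ... W^(n_1)_(- k_1 - n_1 - 1) |0>. *)
Definition W_monomial (vac : V) (s : seq (nat * nat)) : V :=
  foldr (fun p v => rho (W p.1 (- p.2%:Z - p.1%:Z - 1)) v) vac s.

(* nested from the right: :A_j (: A_(j-1) ... :A_2 A_1: :): *)
Definition W_nprod (s : seq (nat * nat)) : distr :=
  foldr (fun p A => nprod (distr_divderiv p.2 (W_field p.1)) A) distr_id s.

Definition state_field_map (vac : V) (Y : V -> distr) : Prop :=
  linear Y /\
  forall s, all (fun p => odd p.1) s -> Y (W_monomial vac s) = W_nprod s.
End FormalDistributions.

(* Main.v *)
(* The coefficient of W^n(z) at z^m is a differential operator t^k q(D) whose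
   polynomial q depends polynomially on m.  Multiplication by z - w acts on the
   coefficients of [W^n(z), W^n'(w)] as a finite difference along the lines on
   which the sum of the two exponents is constant, and there both the operator
   part and the cocycle are polynomial of bounded degree: the generating fields
   are mutually local.  By Dong's lemma so are all the nested normally ordered
   products of their derivatives, and by Goddard's uniqueness argument a field A
   in the span of these products is determined by A(0)|0>.  Since the ordered
   monomials span the module, Y is the inverse of the map A |-> A(0)|0>. *)
From HB Require Import structures.
From mathcomp Require Import all_boot all_order all_algebra finmap.
From mathcomp Require Import monalg ring zify.
From mathcomp Require Import boolp classical_sets functions fsbigop.
From mathcomp Require Import complex reals.
Require Import Defs.

Set Implicit Arguments.
Unset Strict Implicit.
Unset Printing Implicit Defensive.

Import Order.TTheory GRing.Theory Num.Theory.
Local Open Scope ring_scope.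

(** The monomials of all orders are linearly dependent, and in V_c there are further relations that
    vary with c, so the prescribed values of Y raise a question of consistency. It is settled on the
    side of fields: a relation between states forces the same relation between fields. This treats
    M_c and V_c alike, as modules generated by a vector on which P acts by 0 and C by c. The
    structure constants of [W^n_k, W^n'_k'] are never computed. Locality needs only that they are
    polynomial in the modes, and the obstacle is the cocycle, which is defined by cases on the sign
    of r and whose range of summation varies with r. Extended to negative r with the sign given by
    antisymmetry, the sum obeys one difference equation in r for all integers, which yields
    polynomiality across r = 0. All identities are between coefficients applied to a vector, where
    the sums over modes are finite. *)

Section IntegerSums.
Variable U : zmodType.
Implicit Types F G : int -> U.

Definition fin_supp F : Prop :=
  exists A : {fset int}, forall l, l \notin A -> F l = 0.

(** By convention this sum is 0 when the support is infinite, so additivity needs the [fin_supp]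
    conditions. *)
Definition intsum F : U := \sum_(l \in setT) F l.

Lemma intsumE F (A : {fset int}) :
  (forall l, l \notin A -> F l = 0) -> intsum F = \sum_(l <- A) F l.
Proof. exact: fsbigTE. Qed.

Lemma fin_suppD F G : fin_supp F -> fin_supp G -> fin_supp (fun l => F l + G l).
Proof.
move=> [A FA] [B GB]; exists (A `|` B)%fset => l.
by rewrite inE negb_or => /andP[/FA-> /GB->]; rewrite addr0.
Qed.

Lemma fin_suppN F : fin_supp F -> fin_supp (fun l => - F l).
Proof. by move=> [A FA]; exists A => l /FA->; rewrite oppr0. Qed.

Lemma intsumD F G : fin_supp F -> fin_supp G ->
  intsum (fun l => F l + G l) = intsum F + intsum G.
Proof.
move=> [A FA] [B GB]; rewrite !(@intsumE _ (A `|` B)%fset) ?big_split // => l;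
  by rewrite inE negb_or => /andP[lA lB]; rewrite ?FA ?GB ?addr0.
Qed.

Lemma intsumN F : fin_supp F -> intsum (fun l => - F l) = - intsum F.
Proof.
move=> [A FA]; rewrite !(@intsumE _ A) ?sumrN // => l lA.
by rewrite FA ?oppr0.
Qed.

Lemma fin_supp_shift F a : fin_supp F -> fin_supp (fun l => F (l + a)).
Proof.
move=> [A FA]; exists ((fun l => l - a) @` A)%fset => l lA; apply: FA.
apply: contra lA => lA; apply/imfsetP; exists (l + a) => //=.
by rewrite addrK.
Qed.

Lemma intsum_shift F a : intsum (fun l => F (l + a)) = intsum F.
Proof.
rewrite [RHS](reindex_fsbigT (fun l : int => l + a)) //.
by exists (fun l => l - a) => l; rewrite ?addrK ?subrK.
Qed.

Lemma intsum_point F a : (forall l, l != a -> F l = 0) -> intsum F = F a.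
Proof.
move=> Fa; rewrite (@intsumE _ [fset a]%fset) ?big_seq_fset1 // => l.
by rewrite inE => /Fa.
Qed.

Lemma intsum0 : intsum (fun _ => 0) = 0.
Proof. exact: (@intsum_point _ 0). Qed.

Lemma intsum_sign F : fin_supp F ->
  \sum_(m \in [set m : int | 0 <= m]%classic) F m
  + \sum_(m \in [set m : int | m < 0]%classic) F m = intsum F.
Proof.
move=> [A FA].
rewrite [X in X + _]fsbig_mkcond [X in _ + X]fsbig_mkcond.
rewrite -[LHS]/(intsum _ + intsum _) -intsumD.
- congr (intsum _); apply/funext => l; rewrite /patch.
  have [l0|l0] := ltP l 0.
    by rewrite memNset ?mem_set /= ?add0r // leNgt l0.
  by rewrite mem_set ?memNset /= ?addr0 // ltNge l0.
- by exists A => l /FA; rewrite /patch => ->; rewrite if_same.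
- by exists A => l /FA; rewrite /patch => ->; rewrite if_same.
Qed.

Lemma fin_supp_bounded F (a b : int) :
  (forall l, l < a -> F l = 0) -> (forall l, b < l -> F l = 0) -> fin_supp F.
Proof.
move=> Fa Fb; pose s := [seq a + i%:Z | i <- iota 0 `|b - a|.+1].
exists (seq_fset tt s) => l; rewrite seq_fsetE.
have [/Fa//|al] := ltP l a; have [/Fb//|lb] := ltP b l; case/mapP.
by exists `|l - a|%N; [rewrite mem_iota; lia|lia].
Qed.

Lemma intsum_raddf (U' : zmodType) (f : {additive U -> U'}) F : fin_supp F ->
  f (intsum F) = \sum_(l \in [set: int]) f (F l).
Proof.
move=> [A FA]; rewrite (intsumE FA) raddf_sum (@fsbigTE _ _ _ _ A) // => l /FA->.
exact: raddf0.
Qed.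
End IntegerSums.

(** * Powers of commuting additive operators *)

Section IteratedAdditive.
Variable X : zmodType.
Implicit Types (f g h : {additive X -> X}) (x : X).

Lemma iter_raddf0 f n : iter n f 0 = 0.
Proof. by elim: n => //= n ->; rewrite raddf0. Qed.

Lemma iter_raddfD f n x y : iter n f (x + y) = iter n f x + iter n f y.
Proof. by elim: n => //= n ->; rewrite raddfD. Qed.

Lemma iter_raddfN f n x : iter n f (- x) = - iter n f x.
Proof. by elim: n => //= n ->; rewrite raddfN. Qed.

Lemma iter_commute f g n x : (forall y, f (g y) = g (f y)) ->
  iter n f (g x) = g (iter n f x).
Proof. by move=> fg; elim: n => //= n ->. Qed.

Lemma iter_commute2 f g n m x : (forall y, f (g y) = g (f y)) ->
  iter n f (iter m g x) = iter m g (iter n f x).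
Proof. by move=> fg; elim: m => //= m <-; rewrite iter_commute. Qed.

Lemma iter_raddf_kill f n m x : iter n f x = 0 -> iter (m + n) f x = 0.
Proof. by rewrite iterD => ->; rewrite iter_raddf0. Qed.

(** Every term in the binomial expansion of (f - g)^(n + m) contains f^n or g^m. The induction on n
    + m splits off one factor at a time instead of expanding. *)
Lemma iter_subf_kill f g h n m x : (forall y, f (g y) = g (f y)) ->
  (forall y, h y = f y - g y) ->
  iter n f x = 0 -> iter m g x = 0 -> iter (n + m) h x = 0.
Proof.
move=> fg hE; have [k] := ubnP (n + m); elim: k n m x => // k IH n m x.
case: n => [_ /= -> _|n]; first exact: iter_raddf0.
case: m => [_ _ gx|m nmk fx gx]; first by rewrite [x]gx iter_raddf0.
have hB y : iter (n + m.+1) h (f y - g y)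
          = iter (n + m.+1) h (f y) - iter (n + m.+1) h (g y).
  by rewrite iter_raddfD iter_raddfN.
rewrite addSn iterSr hE hB IH ?sub0r; last 3 first.
- by rewrite -addSn; lia.
- by rewrite -iterSr.
- by rewrite iter_commute // gx raddf0.
rewrite -addSnnS IH ?oppr0 //; first lia.
- by rewrite iter_commute // fx raddf0.
- by rewrite -iterSr.
Qed.
End IteratedAdditive.

(** * Multiplication by z - w on arrays of coefficients *)

Section Difference.
Variable U : zmodType.
Implicit Types F G : int -> int -> U.

Definition dif F : int -> int -> U := fun m n => F (m - 1) n - F m (n - 1).

Fact dif_is_additive : zmod_morphism dif.
Proof.
move=> F G; apply/funext => m; apply/funext => n.
by rewrite /dif !fctE !opprD addrACA.
Qed.
HB.instance Definition _ :=
  GRing.isZmodMorphism.Build (int -> int -> U) (int -> int -> U) dif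
    dif_is_additive.

Definition killed F : Prop := exists N, iter N dif F = 0.

Lemma killedD F G : killed F -> killed G -> killed (fun m n => F m n + G m n).
Proof.
move=> [N FN] [M GM]; exists (N + M)%N.
rewrite -[X in iter _ _ X]/(F + G) iter_raddfD (iter_raddf_kill N GM) addr0 addnC.
exact: iter_raddf_kill.
Qed.

Lemma killed_dif F : killed (dif F) -> killed F.
Proof. by move=> [N FN]; exists N.+1; rewrite iterSr. Qed.

Lemma iter_dif_shift N F a b m n :
  iter N dif (fun m n => F (m + a) (n + b)) m n = iter N dif F (m + a) (n + b).
Proof.
by elim: N m n => //= N IH m n; rewrite /dif !IH !(addrAC _ (- 1)).
Qed.
End Difference.
Arguments dif {U} F m n.

Section DifferenceMaps.
Variables U U' : zmodType.

(** Each [dif] lowers m + n by 1 in both of its terms, so a map that depends only on m + n passes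
    through it. *)
Lemma iter_dif_family (L : int -> {additive U -> U'}) N F m n :
  iter N dif (fun m n => L (m + n) (F m n)) m n
  = L (m + n - N%:Z) (iter N dif F m n).
Proof.
elim: N m n => [|N IH] m n /=; first by rewrite subr0.
rewrite /dif !IH raddfB; congr (L _ _ - L _ _); lia.
Qed.

Lemma killed_family (L : int -> {additive U -> U'}) F : killed F ->
  killed (fun m n => L (m + n) (F m n)).
Proof.
move=> [N FN]; exists N; apply/funext => m; apply/funext => n.
by rewrite iter_dif_family FN raddf0.
Qed.

Lemma killed_inj (f : {additive U -> U'}) F : injective f ->
  killed (fun m n => f (F m n)) -> killed F.
Proof.
move=> fI [N FN]; exists N; apply/funext => m; apply/funext => n; apply: fI.
by rewrite -(iter_dif_family (fun _ => f)) FN raddf0.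
Qed.
End DifferenceMaps.

(** A discrete Leibniz rule: [dif] of a product is a sum of two products, each with one factor
    differenced and the other translated. *)
Lemma killedM (A : pzRingType) (F G : int -> int -> A) :
  killed F -> killed G -> killed (fun m n => F m n * G m n).
Proof.
move=> [N FN] [M GM].
have [k] := ubnP (N + M); elim: k N M F G FN GM => // k IH [|N] M F G FN GM.
  by move=> _; exists 0%N => /=; apply/funext => m; apply/funext => n; rewrite [F]FN mul0r.
case: M GM => [|M] GM NMk.
  by exists 0%N => /=; apply/funext => m; apply/funext => n; rewrite [G]GM mulr0.
apply: killed_dif.
have -> : dif (fun m n => F m n * G m n)
    = (fun m n => dif F m n * G (m + - 1) (n + 0) + F (m + 0) (n + - 1) * dif G m n).
  apply/funext => m; apply/funext => n; rewrite /dif !addr0.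
  by rewrite mulrBl mulrBr addrA subrK.
have sh (H : int -> int -> A) l a b : iter l dif H = 0 ->
    iter l dif (fun m n => H (m + a) (n + b)) = 0.
  by move=> H0; apply/funext => m; apply/funext => n; rewrite iter_dif_shift H0.
apply: killedD.
  apply: (IH N M.+1); [by rewrite -iterSr|exact: sh|lia].
by apply: (IH N.+1 M); [exact: sh|rewrite -iterSr|lia].
Qed.

(** The commutator of [dif] with multiplication by m is a translation up to sign, so the factor m
    costs one more power of z - w. *)
Lemma iter_dif_scale (A : pzRingType) (U : lmodType A) N (F : int -> int -> U) :
  iter N dif F = 0 -> iter N.+1 dif (fun m n => m%:~R *: F m n) = 0.
Proof.
elim: N F => [|N IH] F FN.
  rewrite [F]FN; apply/funext => m; apply/funext => n.
  by rewrite /= /dif !scaler0 subr0.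
have -> : iter N.+2 dif (fun m n => m%:~R *: F m n) = iter N.+1 dif
    ((fun m n => m%:~R *: dif F m n) - (fun m n => F (m + - 1) (n + 0))).
  rewrite iterSr; congr (iter _ _ _); apply/funext => m; apply/funext => n.
  by rewrite /dif !fctE !addr0 intrB scalerBl scalerBr scale1r addrAC.
rewrite iter_raddfD iter_raddfN IH; last by rewrite -iterSr.
by apply/funext => m; apply/funext => n; rewrite !fctE iter_dif_shift FN subr0.
Qed.

(** * Coefficients in three variables and restriction to the diagonal *)

Section ThreeVariables.
Variable V : zmodType.
Implicit Types G : int -> int -> int -> V.

(* [G l m n] is the coefficient of z^l w^m x^n; the three operators are the
   multiplications by z - x, z - w and w - x. *)
Definition dzx G : int -> int -> int -> V :=
  fun l m n => G (l - 1) m n - G l m (n - 1).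
Definition dzw G : int -> int -> int -> V :=
  fun l m n => G (l - 1) m n - G l (m - 1) n.
Definition dwx G : int -> int -> int -> V :=
  fun l m n => G l (m - 1) n - G l m (n - 1).

Fact dzx_is_additive : zmod_morphism dzx.
Proof. by move=> F G; do 3!apply/funext => ?; rewrite /dzx !fctE !opprD addrACA. Qed.
Fact dzw_is_additive : zmod_morphism dzw.
Proof. by move=> F G; do 3!apply/funext => ?; rewrite /dzw !fctE !opprD addrACA. Qed.
Fact dwx_is_additive : zmod_morphism dwx.
Proof. by move=> F G; do 3!apply/funext => ?; rewrite /dwx !fctE !opprD addrACA. Qed.
HB.instance Definition _ := GRing.isZmodMorphism.Build
  (int -> int -> int -> V) (int -> int -> int -> V) dzx dzx_is_additive.
HB.instance Definition _ := GRing.isZmodMorphism.Build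
  (int -> int -> int -> V) (int -> int -> int -> V) dzw dzw_is_additive.
HB.instance Definition _ := GRing.isZmodMorphism.Build
  (int -> int -> int -> V) (int -> int -> int -> V) dwx dwx_is_additive.

Lemma dwxE G : dwx G = dzx G - dzw G.
Proof.
do 3!apply/funext => ?; rewrite /dwx /dzx /dzw !fctE.
by rewrite opprB addrC addrA subrK.
Qed.

Lemma dzxzwC G : dzx (dzw G) = dzw (dzx G).
Proof. by do 3!apply/funext => ?; rewrite /dzx /dzw !opprD addrACA. Qed.

Lemma dwxzxC G : dwx (dzx G) = dzx (dwx G).
Proof.
by do 3!apply/funext => ?; rewrite /dzx /dwx !opprD addrACA.
Qed.

Lemma dwxzwC G : dwx (dzw G) = dzw (dwx G).
Proof.
by do 3!apply/funext => ?; rewrite /dzw /dwx !opprD addrACA.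
Qed.

Lemma iter_dzx N G l m n :
  iter N dzx G l m n = iter N dif (fun l n => G l m n) l n.
Proof. by elim: N l n => //= N IH l n; rewrite /dzx /dif !IH. Qed.

Lemma iter_dzw N G l m n :
  iter N dzw G l m n = iter N dif (fun l m => G l m n) l m.
Proof. by elim: N l m => //= N IH l m; rewrite /dzw /dif !IH. Qed.

Lemma iter_dwx N G l m n : iter N dwx G l m n = iter N dif (G l) m n.
Proof. by elim: N m n => //= N IH m n; rewrite /dwx /dif !IH. Qed.

(** The substitution z = w: the coefficient of w^p x^n after the powers of z and w are merged. *)
Definition diag G : int -> int -> V := fun p n => intsum (fun l => G l (p - l) n).

Definition diag_finite G : Prop :=
  forall p n, fin_supp (fun l => G l (p - l) n).

Lemma diag_finite_dwx G : diag_finite G -> diag_finite (dwx G).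
Proof.
move=> fG p n; apply: fin_suppD; last exact/fin_suppN/fG.
have -> : (fun l => G l (p - l - 1) n) = (fun l => G l (p - 1 - l) n).
  by apply/funext => l; rewrite addrAC.
exact: fG.
Qed.

Lemma diag_finite_dzx G : diag_finite G -> diag_finite (dzx G).
Proof.
move=> fG p n; apply: fin_suppD; last exact/fin_suppN/fG.
have -> : (fun l => G (l - 1) (p - l) n)
        = (fun l => (fun l => G l (p - 1 - l) n) (l + - 1)).
  by apply/funext => l /=; congr (G _ _ _); lia.
exact: (fin_supp_shift (F := fun l => G l (p - 1 - l) n) _ (fG _ _)).
Qed.

Lemma dif_diag_wx G : diag_finite G -> dif (diag G) = diag (dwx G).
Proof.
move=> fG; apply/funext => p; apply/funext => n.
have e : (fun l => G l (p - l - 1) n) = (fun l => G l (p - 1 - l) n).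
  by apply/funext => l; rewrite addrAC.
by rewrite /diag /dwx intsumD ?e ?intsumN //; exact/fin_suppN.
Qed.

(* On the diagonal z = w, so that z - x and w - x agree. *)
Lemma dif_diag_zx G : diag_finite G -> dif (diag G) = diag (dzx G).
Proof.
move=> fG; apply/funext => p; apply/funext => n.
have e : (fun l => G (l - 1) (p - l) n)
        = (fun l => (fun l => G l (p - 1 - l) n) (l + - 1)).
  by apply/funext => l /=; congr (G _ _ _); lia.
rewrite /diag /dzx intsumD ?e ?intsumN //; last exact/fin_suppN.
  by rewrite (intsum_shift (fun l => G l (p - 1 - l) n)).
exact: (fin_supp_shift (F := fun l => G l (p - 1 - l) n) _ (fG _ _)).
Qed.

Lemma iter_dif_diag_wx N G : diag_finite G ->
  iter N dif (diag G) = diag (iter N dwx G) /\ diag_finite (iter N dwx G).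
Proof.
move=> fG; elim: N => //= N [-> IH].
by rewrite dif_diag_wx //; split=> //; exact: diag_finite_dwx.
Qed.

Lemma iter_dif_diag_zx N G : diag_finite G ->
  iter N dif (diag G) = diag (iter N dzx G).
Proof.
move=> fG; suff [] : iter N dif (diag G) = diag (iter N dzx G)
                     /\ diag_finite (iter N dzx G) by [].
elim: N => //= N [-> IH].
by rewrite dif_diag_zx //; split=> //; exact: diag_finite_dzx.
Qed.

Lemma diag0 : diag 0 = 0.
Proof. by apply/funext => p; apply/funext => n; apply: intsum0. Qed.
End ThreeVariables.

(** * Locality, normally ordered products and Dong's lemma *)

Section Distributions.
Variables (K : numFieldType) (V : lmodType K).
Implicit Types A B C : distr V.

Definition end_distr A : Prop := forall m, linear (A m).

Lemma end_distr0 A m : end_distr A -> A m 0 = 0.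
Proof. by move=> lA; have := lA m (-1) 0 0; rewrite scaler0 addr0 scaleN1r addNr. Qed.

Lemma end_distrD A m u v : end_distr A -> A m (u + v) = A m u + A m v.
Proof. by move=> lA; have := lA m 1 u v; rewrite !scale1r. Qed.

Lemma end_distrZ A m a v : end_distr A -> A m (a *: v) = a *: A m v.
Proof. by move=> lA; have := lA m a v 0; rewrite end_distr0 // !addr0. Qed.

Lemma end_distrN A m v : end_distr A -> A m (- v) = - A m v.
Proof. by move=> lA; rewrite -scaleN1r end_distrZ // scaleN1r. Qed.

Lemma end_distrB A m u v : end_distr A -> A m (u - v) = A m u - A m v.
Proof. by move=> lA; rewrite end_distrD // end_distrN. Qed.

Fact end_distr_zmod A m : end_distr A -> zmod_morphism (A m).
Proof. by move=> lA u v; rewrite end_distrB. Qed.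

Definition end_additive A m (lA : end_distr A) : {additive V -> V} :=
  HB.pack (A m) (GRing.isZmodMorphism.Build V V (A m) (end_distr_zmod m lA)).

Definition local_order N A B : Prop :=
  forall v, iter N dif (fun m n => distr_comm A B m n v) = 0.

Lemma mutually_localP A B : mutually_local A B <-> exists N, local_order N A B.
Proof.
have e N (F : int -> int -> V -> V) m n v :
    iter N (@mul_zw _ _) F m n v = iter N dif (fun m n => F m n v) m n.
  by elim: N m n => //= N IH m n; rewrite /mul_zw /dif !IH.
split=> -[N AB]; exists N; last by move=> m n v; rewrite e AB.
by move=> v; apply/funext => m; apply/funext => n; rewrite -e.
Qed.

Lemma local_order_map N A B C p v : end_distr C -> local_order N A B ->
  iter N dif (fun m n => C p (distr_comm A B m n v)) = 0.
Proof.
move=> lC AB; apply/funext => m; apply/funext => n.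
have := iter_dif_family (fun _ => end_additive p lC) N
  (fun m n => distr_comm A B m n v) m n.
by rewrite AB /= end_distr0.
Qed.

(** The coefficient of z^l w^m in :A(z)B(w):, whose restriction to z = w is [nprod]. Keeping z and w
    apart is what makes Dong's argument possible. *)
Definition normal_order A B (l m : int) (v : V) : V :=
  if 0 <= l then A l (B m v) else B m (A l v).

Lemma fin_supp_normal_order A B p v : end_distr A -> end_distr B ->
  is_field A -> is_field B ->
  fin_supp (fun l => normal_order A B l (p - l) v).
Proof.
move=> lA lB /(_ v)[a Aa] /(_ v)[b Bb].
(* The absolute values also fix the sign of l, and with it the factor that acts first: A below the
   range, B above it. *)
apply: (@fin_supp_bounded _ _ (- `|a|) `|p - b|) => l la; rewrite /normal_order.
  by rewrite ifN ?Aa ?end_distr0 //; lia.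
by rewrite ifT ?Bb ?end_distr0 //; lia.
Qed.

Lemma nprodE A B p v : end_distr A -> end_distr B -> is_field A -> is_field B ->
  nprod A B p v = intsum (fun l => normal_order A B l (p - l) v).
Proof.
move=> lA lB fA fB; rewrite -intsum_sign; last exact: fin_supp_normal_order.
rewrite /nprod; congr (_ + _); apply: eq_fsbigr => l; rewrite in_setE /= => l0.
  by rewrite /normal_order l0.
by rewrite /normal_order leNgt l0.
Qed.

Lemma nprod_end A B : end_distr A -> end_distr B -> is_field A -> is_field B ->
  end_distr (nprod A B).
Proof.
move=> lA lB fA fB p a u v; rewrite !nprodE //.
have [S Su] := fin_supp_normal_order p u lA lB fA fB.
have [S' Sv] := fin_supp_normal_order p v lA lB fA fB.
have lNO l m : linear (normal_order A B l m).
  by move=> b x y; rewrite /normal_order; case: ifP => _; rewrite ?lA ?lB ?lA.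
rewrite !(@intsumE _ _ (S `|` S')%fset).
- by rewrite scaler_sumr -big_split; apply: eq_bigr => l _; rewrite lNO.
- by move=> l; rewrite inE negb_or => /andP[_ /Sv].
- by move=> l; rewrite inE negb_or => /andP[/Su].
- move=> l; rewrite inE negb_or => /andP[/Su u0 /Sv v0].
  by rewrite lNO u0 v0 scaler0 addr0.
Qed.

Lemma nprod_field A B : end_distr A -> end_distr B -> is_field A -> is_field B ->
  is_field (nprod A B).
Proof.
move=> lA lB fA fB v; have [a Aa] := fA v; have [b Bb] := fB v.
(* Only the finitely many vectors A l v with a <= l < 0 can be nonzero; N is a common truncation
   bound of B on them. *)
have [N NB] : exists N : int, forall l m, a <= l -> l < 0 -> m < N ->
    B (m - l) (A l v) = 0.
  suff [N NB] : exists N : int, forall l : nat, (l < `|a|.+1)%N -> forall m, m < N ->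
      B (m + l%:Z) (A (- l%:Z) v) = 0.
    exists N => l m al l0 mN; have lE : l = - `|l|%N%:Z by lia.
    by rewrite lE opprK NB //; lia.
  elim: `|a|.+1 => [|k [N NB]]; first by exists 0.
  have [c Bc] := fB (A (- k%:Z) v); exists (Num.min N (c - k%:Z)) => l lk m.
  rewrite lt_min => /andP[mN mc]; have [->|lk'] := eqVneq l k; first by apply: Bc; lia.
  by apply: NB => //; lia.
exists (Num.min N b) => m; rewrite lt_min => /andP[mN mb].
rewrite nprodE // -[RHS](intsum0 V); congr intsum; apply/funext => l.
rewrite /normal_order; case: leP => l0; first by rewrite Bb ?end_distr0 //; lia.
by have [la|al] := ltP l a; [rewrite Aa ?end_distr0|exact: NB].
Qed.

(* Dong's lemma.  For the normally ordered product E in two variables,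
   [E(z, w), C(x)] = A [B, C] + [A, C] B - [[A, B], C]_-, the last term being cut
   off to negative powers of z.  A power of w - x kills the first term.  It also
   kills the last one: [A, [B, C]] is killed by a power of w - x, and up to it
   [[A, B], C] is [[A, C], B], killed by powers of both z - w and z - x.
   On the diagonal z = w the remaining term is killed by a power of z - x. *)
Lemma nprod_local A B C a b c :
  end_distr A -> end_distr B -> end_distr C -> is_field A -> is_field B ->
  local_order a A B -> local_order b A C -> local_order c B C ->
  local_order (b + (c + (b + a))) (nprod A B) C.
Proof.
move=> lA lB lC fA fB AB AC BC v.
pose H l m n : V := normal_order A B l m (C n v) - C n (normal_order A B l m v).
pose H1 l m n := A l (distr_comm B C m n v).
pose H2 l m n := distr_comm A C l n (B m v).
pose K' l m n := distr_comm A C l n (B m v) - B m (distr_comm A C l n v).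
pose K1 l m n := A l (distr_comm B C m n v) - distr_comm B C m n (A l v).
pose K2 l m n := distr_comm A B l m (C n v) - C n (distr_comm A B l m v).
pose cut l m n := if l < 0 then K2 l m n else 0.
have tel (x y z : V) : y - z + (x - y) = x - z by rewrite addrC addrA subrK.
have K2E : K2 = K' + K1.
  do 3!apply/funext => ?; rewrite /K2 /K' /K1 !fctE /distr_comm.
  rewrite !(end_distrB _ _ _ lA, end_distrB _ _ _ lB, end_distrB _ _ _ lC).
  by rewrite !opprB [RHS]addrACA !tel addrACA [RHS]addrACA (addrC (- _)).
have HE : H = H1 + H2 - cut.
  apply/funext => l; apply/funext => m; apply/funext => n.
  rewrite /H /H1 /H2 /cut /K2 !fctE /normal_order /distr_comm.
  rewrite !(end_distrB _ _ _ lA, end_distrB _ _ _ lC) leNgt.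
  case: (l < 0) => /=; last by rewrite subr0 addrA subrK.
  rewrite addrA subrK.
  have tel' (x y z w : V) : x - z - (x - y - (z - w)) = y - w.
    by rewrite [- (x - y - _)]opprB addrA subrKA [- (x - y)]opprB tel.
  by rewrite tel'.
have fH : diag_finite H.
  move=> p n; apply: fin_suppD; first exact: fin_supp_normal_order.
  apply: fin_suppN; have [S Sv] := fin_supp_normal_order p v lA lB fA fB.
  by exists S => l /Sv->; rewrite end_distr0.
have -> : (fun p n => distr_comm (nprod A B) C p n v) = diag H.
  apply/funext => p; apply/funext => n; rewrite /distr_comm /diag.
  rewrite intsumD; last 2 first.
  - exact: fin_supp_normal_order.
  - apply: fin_suppN; have [S Sv] := fin_supp_normal_order p v lA lB fA fB.
    by exists S => l /Sv->; rewrite end_distr0.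
  have fv := fin_supp_normal_order p v lA lB fA fB.
  rewrite intsumN; last first.
    by have [S Sv] := fv; exists S => l /Sv->; rewrite end_distr0.
  rewrite !nprodE //; congr (_ - _).
  exact: (intsum_raddf (end_additive n lC) fv).
have iterB N (f : {additive (int -> int -> int -> V) -> (int -> int -> int -> V)}) x y :
    iter N f x = 0 -> iter N f y = 0 -> iter N f (x - y) = 0.
  by move=> fx fy; rewrite iter_raddfD iter_raddfN fx fy subr0.
have zxK' : iter b (@dzx V) K' = 0.
  apply: (iterB b (@dzx V) (fun l m n => distr_comm A C l n (B m v))
    (fun l m n => B m (distr_comm A C l n v))).
    by apply/funext => l; apply/funext => m; apply/funext => n; rewrite iter_dzx AC.
  apply/funext => l; apply/funext => m; apply/funext => n.
  by rewrite iter_dzx local_order_map.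
have zwK2 : iter a (@dzw V) K2 = 0.
  apply: (iterB a (@dzw V) (fun l m n => distr_comm A B l m (C n v))
    (fun l m n => C n (distr_comm A B l m v))).
    by apply/funext => l; apply/funext => m; apply/funext => n; rewrite iter_dzw AB.
  apply/funext => l; apply/funext => m; apply/funext => n.
  by rewrite iter_dzw local_order_map.
have wxH1 : iter c (@dwx V) H1 = 0.
  apply/funext => l; apply/funext => m; apply/funext => n.
  by rewrite iter_dwx local_order_map.
have wxK1 : iter c (@dwx V) K1 = 0.
  apply: (iterB c (@dwx V) H1 (fun l m n => distr_comm B C m n (A l v))) => //.
  by apply/funext => l; apply/funext => m; apply/funext => n; rewrite iter_dwx BC.
have wxK2 : iter (c + (b + a)) (@dwx V) K2 = 0.
  have zxY : iter b (@dzx V) (iter c (@dwx V) K2) = 0.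
    rewrite K2E iter_raddfD wxK1 addr0 -iter_commute2 ?zxK' ?iter_raddf0 //.
    exact: dwxzxC.
  have zwY : iter a (@dzw V) (iter c (@dwx V) K2) = 0.
    rewrite -iter_commute2 ?zwK2 ?iter_raddf0 //; exact: dwxzwC.
  rewrite addnC iterD.
  exact: (@iter_subf_kill _ (@dzx V) (@dzw V) (@dwx V) b a _
            (@dzxzwC V) (@dwxE V) zxY zwY).
(* Multiplication by w - x leaves l unchanged, so it commutes with the cut at l < 0; z - w and z - x
   do not. *)
have wxcut : iter (c + (b + a)) (@dwx V) cut = 0.
  apply/funext => l; apply/funext => m; apply/funext => n; rewrite iter_dwx /cut.
  case: (l < 0); first by rewrite -(iter_dwx _ K2) wxK2.
  exact: (f_equal (fun F => F m n) (iter_raddf0 (@dif V) _)).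
(* The exponent is spent in two ways: c + (b + a) factors act as w - x and kill [H1] and [cut]; the
   other b act as z - x and kill [H2]. *)
rewrite iterD; have [-> fwH] := iter_dif_diag_wx (c + (b + a)) fH.
rewrite iter_dif_diag_zx // HE iter_raddfD iter_raddfN wxcut subr0 iter_raddfD.
rewrite addnC (iter_raddf_kill _ wxH1) add0r addnC -iter_commute2; last exact: dwxzxC.
have -> : iter b (@dzx V) H2 = 0.
  by apply/funext => l; apply/funext => m; apply/funext => n; rewrite iter_dzx AC.
by rewrite iter_raddf0 diag0.
Qed.
End Distributions.

(** * Closure properties of translation-covariant fields; Goddard's uniqueness *)

Section FieldAlgebra.
Variables (K : numFieldType) (V : lmodType K).
Implicit Types A B C : distr V.

Lemma mutually_local_sym A B : mutually_local A B -> mutually_local B A.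
Proof.
move=> /mutually_localP[N AB]; apply/mutually_localP; exists N => v.
have e (F : int -> int -> V) m n :
    iter N dif (fun m n => - F n m) m n = - (-1) ^+ N *: iter N dif F n m.
  elim: N {AB} m n => [|N IH] m n /=; first by rewrite expr0 scaleN1r.
  rewrite /dif !IH -scalerBr exprS mulN1r opprK -[RHS]opprK -scalerN -scaleNr.
  by rewrite opprB.
apply/funext => m; apply/funext => n.
rewrite (_ : (fun m n => _) = fun m n => - distr_comm A B n m v).
  by rewrite (e (fun m n => distr_comm A B m n v)) AB scaler0.
by apply/funext => k; apply/funext => l; rewrite /distr_comm opprB.
Qed.

Lemma mutually_localZD a A B C : end_distr C ->
  mutually_local A C -> mutually_local B C -> mutually_local (a *: A + B) C.
Proof.
move=> lC /mutually_localP[N AC] /mutually_localP[M BC]; apply/mutually_localP.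
exists (N + M)%N => v.
rewrite (_ : (fun m n => _) = (fun m n => a *: distr_comm A C m n v)
                            + (fun m n => distr_comm B C m n v)); last first.
  apply/funext => k; apply/funext => l; rewrite /distr_comm !fctE.
  by rewrite lC scalerBr opprD addrACA.
rewrite iter_raddfD (iter_raddf_kill _ (BC v)) addr0 addnC.
apply: iter_raddf_kill; apply/funext => m; apply/funext => n.
have := iter_dif_family (fun _ => *:%R a : {additive V -> V}) N
  (fun m n => distr_comm A C m n v) m n.
by rewrite AC /= scaler0.
Qed.

Lemma distr_deriv_end A : end_distr A -> end_distr (distr_deriv A).
Proof. by move=> lA m a u v; rewrite /distr_deriv lA scalerDr !scalerA mulrC. Qed.

Lemma distr_deriv_field A : is_field A -> is_field (distr_deriv A).
Proof.
move=> fA v; have [N AN] := fA v; exists (N - 1) => m mN.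
by rewrite /distr_deriv AN ?scaler0 //; lia.
Qed.

Lemma distr_deriv_local A B : end_distr B ->
  mutually_local A B -> mutually_local (distr_deriv A) B.
Proof.
move=> lB /mutually_localP[N AB]; apply/mutually_localP; exists N.+1 => v.
apply/funext => m; apply/funext => n.
have := iter_dif_shift N.+1 (fun m n => m%:~R *: distr_comm A B m n v) 1 0 m n.
rewrite (iter_dif_scale (AB v)) => H; apply: etrans H; congr (iter _ _ _ m n).
apply/funext => k; apply/funext => l; rewrite /distr_comm /distr_deriv addr0.
by rewrite end_distrZ // scalerBr.
Qed.

Lemma nprod_mutually_local A B C :
  end_distr A -> end_distr B -> end_distr C -> is_field A -> is_field B ->
  mutually_local A B -> mutually_local A C -> mutually_local B C ->
  mutually_local (nprod A B) C.
Proof.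
move=> lA lB lC fA fB /mutually_localP[a AB] /mutually_localP[b AC].
move=> /mutually_localP[c BC]; apply/mutually_localP.
by exists (b + (c + (b + a)))%N; apply: nprod_local.
Qed.

Variables (vac : V) (T : V -> V).
Hypotheses (Tlin : linear T) (Tvac : T vac = 0).

Definition covariant A : Prop :=
  forall m v, T (A m v) - A m (T v) = distr_deriv A m v.

(** What the axioms ask of one field [Y a] taken alone, without reference to the state a. *)
Record state_field A : Prop := {
  sf_end : end_distr A;
  sf_field : is_field A;
  sf_covariant : covariant A;
  sf_vac : forall m, m < 0 -> A m vac = 0
}.

Let TD u v : T (u + v) = T u + T v.
Proof. by have := Tlin 1 u v; rewrite !scale1r. Qed.
Let T0 : T 0 = 0.
Proof. by have := Tlin (-1) 0 0; rewrite scaler0 addr0 scaleN1r addNr. Qed.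
Let TZ a v : T (a *: v) = a *: T v.
Proof. by have := Tlin a v 0; rewrite T0 !addr0. Qed.

Fact T_zmod : zmod_morphism T.
Proof. by move=> u v; rewrite TD -scaleN1r TZ scaleN1r. Qed.

Lemma state_field0 : state_field 0.
Proof.
split=> [m a u v|v|m v|m _] //.
- by rewrite -[RHS]/(a *: (0 : V) + 0) scaler0 addr0.
- by exists 0.
- by rewrite -[LHS]/(T 0 - 0) T0 subr0 -[RHS]/((m + 1)%:~R *: (0 : V)) scaler0.
Qed.

Lemma state_field_id : state_field (@distr_id K V).
Proof.
split=> [m a u v|v|m v|m m0].
- by rewrite /distr_id; case: ifP; rewrite ?scaler0 ?addr0.
- by exists 0 => m m0; rewrite /distr_id ifN //; lia.
- rewrite /distr_deriv /distr_id; case: eqP => _; rewrite ?T0 subrr.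
    by case: eqP => [->|]; rewrite ?scale0r ?scaler0.
  by case: eqP => [->|]; rewrite ?scale0r ?scaler0.
- by rewrite /distr_id ifN //; lia.
Qed.

Lemma state_fieldZD a A B :
  state_field A -> state_field B -> state_field (a *: A + B).
Proof.
move=> [lA fA cA vA] [lB fB cB vB]; split=> [m b u v|v|m v|m m0]; rewrite ?fctE.
- by rewrite lA lB !scalerDr !scalerA [a * b]mulrC addrACA.
- have [M AM] := fA v; have [N BN] := fB v; exists (Num.min M N) => m.
  by rewrite lt_min => /andP[mM mN]; rewrite !fctE AM ?BN // scaler0 addr0.
- rewrite TD TZ opprD addrACA -scalerBr cA cB /distr_deriv !fctE.
  by rewrite scalerDr !scalerA mulrC.
- by rewrite vA ?vB // scaler0 addr0.
Qed.

Lemma state_field_deriv A : state_field A -> state_field (distr_deriv A).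
Proof.
move=> [lA fA cA vA]; split=> [|||m m0].
- exact: distr_deriv_end.
- exact: distr_deriv_field.
- by move=> m v; rewrite /distr_deriv TZ -scalerBr cA.
- rewrite /distr_deriv; have [->|m1] := eqVneq m (- 1).
    by rewrite addNr scale0r.
  by rewrite vA ?scaler0 //; lia.
Qed.

Lemma state_field_nprod A B :
  state_field A -> state_field B -> state_field (nprod A B).
Proof.
move=> [lA fA cA vA] [lB fB cB vB]; split=> [||p v|p p0].
- exact: nprod_end.
- exact: nprod_field.
- have fs q w : fin_supp (fun l => normal_order A B l (q - l) w).
    exact: fin_supp_normal_order.
  pose T' : {additive V -> V} :=
    HB.pack T (GRing.isZmodMorphism.Build V V T T_zmod).
  pose NO l m w := normal_order A B l m w.
  have comm l m : T (NO l m v) - NO l m (T v)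
      = (l + 1)%:~R *: NO (l + 1) m v + (m + 1)%:~R *: NO l (m + 1) v.
    have TAB C D k q : end_distr C -> covariant C -> covariant D ->
        T (C k (D q v)) - C k (D q (T v))
        = (k + 1)%:~R *: C (k + 1) (D q v) + (q + 1)%:~R *: C k (D (q + 1) v).
      move=> lC cC cD; rewrite -(subrKA (C k (T (D q v)))) -end_distrB // cC cD.
      by rewrite /distr_deriv end_distrZ.
    rewrite /NO /normal_order; case: leP => l0.
      by rewrite ifT ?(TAB A B) //; lia.
    rewrite (TAB B A) // addrC; congr (_ + _).
    (* Differentiating A moves l to l + 1, which crosses the cut only at l = -1, where the factor l
       + 1 vanishes. *)
    have [->|l1] := eqVneq l (- 1); first by rewrite addNr !scale0r.
    by rewrite ifN //; lia.
  have fsZ (h : int -> int) q : fin_supp (fun l => (h l)%:~R *: NO l (q - l) v).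
    by have [S Sv] := fs q v; exists S => l /Sv; rewrite /NO => ->; rewrite scaler0.
  rewrite /distr_deriv !nprodE // [T _](intsum_raddf T' (fs p v)).
  rewrite -intsumN // -[LHS]intsumD; last 2 first.
  - have [S Sv] := fs p v; exists S => l /Sv->; exact: T0.
  - exact/fin_suppN.
  rewrite (_ : (fun l => _) = fun l => (l + 1)%:~R *: NO (l + 1) (p + 1 - (l + 1)) v
                           + (p + 1 - l)%:~R *: NO l (p + 1 - l) v); last first.
    apply/funext => l; rewrite [LHS]comm.
    by congr (_ *: NO _ _ _ + _%:~R *: NO _ _ _); lia.
  rewrite intsumD //; last first.
    exact: (fin_supp_shift (F := fun l => l%:~R *: NO l (p + 1 - l) v) 1 (fsZ id _)).
  (* After the shift the factors l and p + 1 - l add up to p + 1, the factor in the derivative of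
     the product. *)
  rewrite (intsum_shift (fun l => l%:~R *: NO l (p + 1 - l) v)) -intsumD //.
  rewrite [RHS](intsum_raddf ( *:%R (p + 1)%:~R : {additive V -> V}) (fs _ _)).
  congr intsum; apply/funext => l /=.
  by rewrite -scalerDl -intrD subrKC.
- rewrite nprodE // -[RHS](intsum0 V); congr intsum; apply/funext => l.
  rewrite /normal_order; case: leP => l0; last by rewrite vA ?end_distr0.
  by rewrite vB ?end_distr0 //; lia.
Qed.

Lemma nprod_vac0 A B : state_field A -> state_field B ->
  nprod A B 0 vac = A 0 (B 0 vac).
Proof.
move=> [lA fA cA vA] [lB fB cB vB]; rewrite nprodE // (intsum_point (a := 0)).
  by rewrite /normal_order lexx subr0.
move=> l l0; rewrite /normal_order; case: leP => lt0; last by rewrite vA ?end_distr0.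
by rewrite vB ?end_distr0 //; lia.
Qed.

(* Goddard's uniqueness: (z - w)^N A(z) B(w)|0> = 0, and B(w)|0> has no negative
   powers of w, so that A(z) B(w)|0> itself vanishes. *)
Lemma goddard A B : state_field A -> state_field B -> mutually_local A B ->
  A 0 vac = 0 -> forall m, A m (B 0 vac) = 0.
Proof.
move=> [lA fA cA vA] [lB fB cB vB] /mutually_localP[N AB] A0 m.
(* The series y(z) = A(z)|0> solves y' = T y with y(0) = 0. *)
have Av k : A k vac = 0.
  have [/vA//|] := ltP k 0; case: k => // k _; elim: k => // k IH.
  have := cA k vac; rewrite Tvac end_distr0 // IH T0 subrr /distr_deriv => /esym/eqP.
  by rewrite scaler_eq0 intr_eq0 -PoszD addn1 /= => /eqP.
suff FN (F : int -> int -> V) M : (forall k (l : int), l < 0 -> F k l = 0) ->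
    iter M dif F = 0 -> F = 0.
  suff E : (fun k l => A k (B l vac)) = 0 by exact: (f_equal (fun G => G m 0) E).
  apply: (FN _ N) => [k l l0|]; first by rewrite vB ?end_distr0.
  rewrite -[RHS](AB vac); congr (iter _ _ _).
  by apply/funext => k; apply/funext => l; rewrite /distr_comm Av end_distr0 ?subr0.
(* If (z - w) F = 0, then F k l = F (k + 1) (l - 1), and descending in l reaches l < 0, where F
   vanishes. *)
elim: M F => // M IH F Fn; rewrite iterSr => FM.
have dF : dif F = 0.
  by apply: IH => // k l l0; rewrite /dif !Fn ?subrr //; lia.
apply/funext => k; apply/funext => l; have [/Fn//|] := ltP l 0.
case: l => // l _; elim: l k => [|l IHl] k.
  have := f_equal (fun G => G (k + 1) 0) dF; rewrite /dif addrK => /eqP.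
  by rewrite subr_eq0 => /eqP->; rewrite Fn.
have := f_equal (fun G => G (k + 1) l.+1%:Z) dF; rewrite /dif addrK => /eqP.
by rewrite subr_eq0 => /eqP->; rewrite (_ : l.+1%:Z - 1 = l) ?IHl //; lia.
Qed.
End FieldAlgebra.

(** * Reconstruction of Y from local fields whose states span *)

Section Reconstruction.
Variables (K : numFieldType) (V : lmodType K) (vac : V) (T : V -> V).
Hypotheses (Tlin : linear T) (Tvac : T vac = 0).
Variable P : distr V -> Prop.
Hypotheses (P_id : P (@distr_id K V)) (P_field : forall A, P A -> state_field vac T A).
Hypothesis P_local : forall A B, P A -> P B -> mutually_local A B.
Hypothesis P_full : forall v, in_span (fun u => exists2 A, P A & A 0 vac = u) v.

Let Q (A : distr V) : Prop := @in_span K (int -> V -> V) P A.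

Let QP A : P A -> Q A.
Proof.
move=> PA; rewrite /Q -[A]addr0 -[A]scale1r.
by apply: in_spanZD => //; exact: in_span0.
Qed.

Let QZD a A B : Q A -> Q B -> Q (a *: (A : int -> V -> V) + B).
Proof.
move=> QA QB; rewrite /Q; elim: QA => [|b {}A A' PA _ IH].
  by rewrite scaler0 add0r.
by rewrite scalerDr scalerA -addrA; apply: in_spanZD.
Qed.

Let Q_field A : Q A -> state_field vac T A.
Proof.
rewrite /Q; elim=> [|a {}A B PA _ IH]; first exact: state_field0.
exact: state_fieldZD (P_field PA) IH.
Qed.

Let Q_local A B : Q A -> Q B -> mutually_local A B.
Proof.
have local0 C : end_distr C -> mutually_local 0 C.
  move=> lC; exists 0%N => m n v; rewrite /distr_comm /=.
  by rewrite -[LHS]/(0 - C n 0) end_distr0 ?subr0.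
move=> QA QB; have lB := sf_end (Q_field QB).
move: QA; rewrite /Q; elim=> [|a {}A A' PA _ IH]; first exact: local0.
apply: mutually_localZD => //; apply: mutually_local_sym.
have lA := sf_end (P_field PA).
move: QB; rewrite /Q; elim=> [|b {IH lB}B B' PB _ IH]; first exact: local0.
by apply: mutually_localZD => //; exact: P_local.
Qed.

Let Q_full v : exists A, Q A /\ A 0 vac = v.
Proof.
elim: (P_full v) => [|a _ u [A PA <-] _ [B [QB <-]]].
  by exists 0; split=> //; exact: in_span0.
exists (a *: (A : int -> V -> V) + B); split=> //.
by apply: QZD => //; exact: QP.
Qed.

(** Uniqueness applied to A - B annihilates every state C 0 vac, and by [Q_full] these exhaust V.
    This is what makes Y well defined. *)
Let Q_inj A B : Q A -> Q B -> A 0 vac = B 0 vac -> A = B.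
Proof.
move=> QA QB AB; suff E : (A : int -> V -> V) - B = 0.
  by apply/eqP; rewrite -subr_eq0; apply/eqP.
have QD : Q ((A : int -> V -> V) - B).
  by rewrite /Q addrC -scaleN1r; apply: QZD.
apply/funext => m; apply/funext => v; have [C [QC <-]] := Q_full v.
apply: (goddard Tlin Tvac (Q_field QD) (Q_field QC)); first exact: Q_local.
by rewrite !fctE AB subrr.
Qed.

Lemma reconstruction : exists Y : V -> distr V,
  [/\ linear Y, forall A, P A -> Y (A 0 vac) = A & vertex_algebra vac T Y].
Proof.
(* By [Q_inj] the chosen field is the only one in Q with state v, whence linearity. *)
pose Y v : distr V := projT1 (cid (Q_full v)).
have QY v : Q (Y v) by rewrite /Y; case: cid => A [].
have Yv v : Y v 0 vac = v by rewrite /Y; case: cid => A [].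
have YQ A : Q A -> Y (A 0 vac) = A by move=> QA; exact: Q_inj.
have Ylin : linear Y.
  by move=> a u v; apply: Q_inj => //; [exact: QZD|rewrite !fctE !Yv].
exists Y; split=> //; first by move=> A /QP/YQ.
have Yf v := Q_field (QY v).
split=> //.
- by move=> a; apply: sf_end.
- by move=> a; apply: sf_field.
- by move=> a m v; rewrite (sf_covariant (Yf a)).
- by rewrite -[in LHS](_ : @distr_id K V 0 vac = vac) ?YQ //; exact: QP.
- by move=> a; split=> // m; exact: sf_vac.
- by move=> a b; exact: Q_local.
Qed.
End Reconstruction.

(** * Polynomial dependence on the exponents *)

Section PolynomialFunctions.
Variable K : numFieldType.
Implicit Types (f g : {poly K}) (F G : int -> int -> {poly K}).

(** Polynomials in m and n over K[X], as a closure: a property is then proved on generators, sums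
    and products, with no normal form for the coefficients. *)
Inductive polyfun : (int -> int -> {poly K}) -> Prop :=
| polyfun_cst f : polyfun (fun _ _ => f)
| polyfun_fst : polyfun (fun m _ => m%:~R%:P)
| polyfun_snd : polyfun (fun _ n => n%:~R%:P)
| polyfunD F G : polyfun F -> polyfun G -> polyfun (fun m n => F m n + G m n)
| polyfunM F G : polyfun F -> polyfun G -> polyfun (fun m n => F m n * G m n).

Lemma polyfunN F : polyfun F -> polyfun (fun m n => - F m n).
Proof.
move=> pF; rewrite (_ : (fun m n => _) = fun m n => (-1) * F m n).
  by apply: polyfunM => //; exact: polyfun_cst.
by apply/funext => m; apply/funext => n; rewrite mulN1r.
Qed.

Lemma polyfun_comp F G : polyfun F -> polyfun G ->
  polyfun (fun m n => F m n \Po G m n).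
Proof.
move=> pF pG; elim: pF => [f|||{}F F' _ IH _ IH'|{}F F' _ IH _ IH'].
- elim/poly_ind: f => [|f a IH].
    rewrite (_ : (fun m n => _) = fun _ _ => 0); first exact: polyfun_cst.
    by apply/funext => m; apply/funext => n; rewrite comp_poly0.
  rewrite (_ : (fun m n => _) = fun m n => (f \Po G m n) * G m n + a%:P).
    by apply: polyfunD; [exact: polyfunM|exact: polyfun_cst].
  apply/funext => m; apply/funext => n.
  by rewrite comp_polyD comp_polyM comp_polyX comp_polyC.
- rewrite (_ : (fun m n => _) = fun m _ => m%:~R%:P); first exact: polyfun_fst.
  by apply/funext => m; apply/funext => n; rewrite comp_polyC.
- rewrite (_ : (fun m n => _) = fun _ n => n%:~R%:P); first exact: polyfun_snd.
  by apply/funext => m; apply/funext => n; rewrite comp_polyC.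
- rewrite (_ : (fun m n => _) = fun m n => (F m n \Po G m n) + (F' m n \Po G m n)).
    exact: polyfunD.
  by apply/funext => m; apply/funext => n; rewrite comp_polyD.
- rewrite (_ : (fun m n => _) = fun m n => (F m n \Po G m n) * (F' m n \Po G m n)).
    exact: polyfunM.
  by apply/funext => m; apply/funext => n; rewrite comp_polyM.
Qed.

Lemma polyfun_affine (a b c : int) :
  polyfun (fun m n => (a * m + b * n + c)%:~R%:P).
Proof.
rewrite (_ : (fun m n => _) = fun m n => a%:~R%:P * m%:~R%:P
                                       + b%:~R%:P * n%:~R%:P + c%:~R%:P).
  apply: polyfunD; last exact: polyfun_cst.
  by apply: polyfunD; apply: polyfunM; constructor.
by apply/funext => m; apply/funext => n; rewrite !intrD !intrM !polyCD !polyCM.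
Qed.

Lemma polyfun_shift F (a b c : int) : polyfun F ->
  polyfun (fun m n => shift (a * m + b * n + c)%:~R (F m n)).
Proof.
move=> pF; apply: polyfun_comp => //.
apply: polyfunD; [exact: polyfun_cst|exact: polyfun_affine].
Qed.

Lemma polyfun_translate F a b : polyfun F -> polyfun (fun m n => F (m + a) (n + b)).
Proof.
elim=> [f|||{}F F' _ IH _ IH'|{}F F' _ IH _ IH'].
- exact: polyfun_cst.
- rewrite (_ : (fun m n => _) = fun m n => (1 * m + 0 * n + a)%:~R%:P).
    exact: polyfun_affine.
  by apply/funext => m; apply/funext => n; rewrite mul1r mul0r addr0.
- rewrite (_ : (fun m n => _) = fun m n => (0 * m + 1 * n + b)%:~R%:P).
    exact: polyfun_affine.
  by apply/funext => m; apply/funext => n; rewrite mul1r mul0r add0r.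
- exact: polyfunD IH IH'.
- exact: polyfunM IH IH'.
Qed.

Lemma polyfun_killed F : polyfun F -> killed F.
Proof.
(* On the generators [dif] is constant (0, -1 or 1), so a second application gives 0. *)
have dif2 (G : int -> int -> {poly K}) :
    (forall m n k l, dif G m n = dif G k l) -> killed G.
  move=> G0; exists 2 => /=; apply/funext => m; apply/funext => n.
  by rewrite {1}/dif (G0 _ _ m (n - 1)) subrr.
elim=> [f|||{}F F' _ IH _ IH'|{}F F' _ IH _ IH'].
- by apply: dif2 => m n k l; rewrite /dif !subrr.
- by apply: dif2 => m n k l; rewrite /dif -!polyCB -!intrB; congr (_%:~R%:P); lia.
- by apply: dif2 => m n k l; rewrite /dif -!polyCB -!intrB; congr (_%:~R%:P); lia.
- exact: killedD.
- exact: killedM.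
Qed.

Lemma polyfun_dif F : polyfun F -> polyfun (dif F).
Proof.
move=> pF; rewrite (_ : dif F = fun m n => F (m + - 1) (n + 0) + - F (m + 0) (n + - 1)).
  by apply: polyfunD; [|apply: polyfunN]; exact: polyfun_translate.
by apply/funext => m; apply/funext => n; rewrite !addr0.
Qed.

Lemma killed_horner F (a b c : int) : polyfun F ->
  killed (fun m n => (F m n).[(a * m + b * n + c)%:~R]).
Proof.
move=> pF; have := polyfun_killed (polyfun_comp pF (polyfun_affine a b c)).
move=> /(killed_family (fun _ => horner_eval (0 : K) : {additive _ -> _})).
congr killed; apply/funext => m; apply/funext => n.
by rewrite /= /horner_eval comp_polyCr hornerC.
Qed.

(* The sum of f(j) over -r <= j <= -1, extended to r < 0 so that
   discrete_sum (r + 1) f - discrete_sum r f = f(-r-1) for all r. *)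
Definition discrete_sum (r : int) f : K :=
  match r with
  | Posz m => \sum_(i < m) f.[i%:R - m%:R]
  | Negz m => - \sum_(i < m.+1) f.[i%:R]
  end.

Fact discrete_sum_is_linear r : linear (discrete_sum r : {poly K} -> K^o).
Proof.
move=> a f g; rewrite /discrete_sum; case: r => m.
  by rewrite scaler_sumr -big_split; apply: eq_bigr => i _; rewrite hornerD hornerZ.
rewrite scalerN -opprD scaler_sumr -big_split; congr (- _).
by apply: eq_bigr => i _; rewrite hornerD hornerZ.
Qed.

Fact discrete_sum_zmod r : zmod_morphism (discrete_sum r).
Proof.
move=> f g; rewrite addrC -scaleN1r.
by rewrite [LHS]discrete_sum_is_linear scaleN1r addrC.
Qed.

Lemma discrete_sumS r f :
  discrete_sum (r + 1) f = discrete_sum r f + f.[(- r - 1)%:~R].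
Proof.
case: r => m.
  rewrite -PoszD addn1 /discrete_sum big_ord_recl /= addrC; congr (_ + _).
    apply: eq_bigr => i _; congr (f.[_]).
    by rewrite /bump /= add1n !mulrS opprD addrACA subrr add0r.
  by congr (f.[_]); rewrite sub0r (_ : - m%:Z - 1 = - m.+1%:Z) ?rmorphN //; lia.
have -> : - Negz m - 1 = m by lia.
case: m => [|m]; first by rewrite /discrete_sum /= big_ord0 big_ord1 addNr.
have -> : Negz m.+1 + 1 = Negz m by lia.
by rewrite /discrete_sum [in RHS]big_ord_recr /= opprD subrK.
Qed.

(** [dif] of the sum is the sum of [dif F] plus a boundary term by [discrete_sumS]. That term is a
    value of F at an affine point, hence killed, and the induction is on the order at which F
    dies. *)
Lemma killed_discrete_sum F c : polyfun F ->
  killed (fun m n => discrete_sum (c - m) (F m n)).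
Proof.
move=> pF; have [N] := polyfun_killed pF; elim: N F pF => [|N IH] F pF FN.
  exists 0%N; apply/funext => m; apply/funext => n; rewrite /= [F]FN.
  by have := discrete_sum_zmod (c - m) 0 0; rewrite !subrr.
apply: killed_dif.
rewrite (_ : dif _ = fun m n => discrete_sum (c - m) (dif F m n)
    + (F (m + - 1) (n + 0)).[(1 * m + 0 * n + (- c - 1))%:~R]).
  apply: killedD; first by apply: IH; [exact: polyfun_dif|rewrite -iterSr].
  exact/killed_horner/polyfun_translate.
apply/funext => m; apply/funext => n; rewrite /dif discrete_sum_zmod.
rewrite (_ : c - (m - 1) = c - m + 1); last lia.
rewrite discrete_sumS addr0 addrAC; congr (_ + _ + _.[_%:~R]); lia.
Qed.

(** The antisymmetry of the cocycle matches the sign in [discrete_sum] at negative r, so the case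
    distinction disappears. *)
Lemma Psi_monoE r f s g :
  Psi_mono r f s g = if r + s == 0 then discrete_sum r (f * shift r%:~R g) else 0.
Proof.
rewrite /Psi_mono; case: ifP => // _; case: r => m; rewrite /Psi_sum /discrete_sum.
  by apply: eq_bigr => i _; rewrite hornerM /shift horner_comp !hornerE subrK.
congr (- _); apply: eq_bigr => i _; rewrite hornerM /shift horner_comp !hornerE mulrC.
by rewrite NegzE rmorphN.
Qed.
End PolynomialFunctions.

(** * The operators W^n_k: locality and translation *)

Section WOperators.
Variable K : numFieldType.
Implicit Types (f g : {poly K}) (n : nat) (k : int).

(** The polynomial of t^n d_t^n in the variable D. *)
Definition falling n : {poly K} := \prod_(i < n) ('X - (i%:R)%:P).

Definition Wpoly n k : {poly K} :=
  - 2^-1 *: (falling n + (-1) ^+ n.+1 *: shift (k + n%:Z)%:~R (falling n)).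

Lemma W_opE n k : W_op K n k = tD k (Wpoly n k).
Proof.
rewrite /W_op dt_powE !Dmul_tD mulr1.
rewrite (_ : k + n%:Z + - n%:Z = k) ?addrK // (_ : - n%:Z + (k + n%:Z) = k); last lia.
have -> : shift (- n%:Z)%:~R 1 = 1 :> {poly K} by rewrite /shift comp_polyC.
by rewrite mul1r -linearZ -linearD -linearZ.
Qed.

Lemma shiftB a f g : shift a (f - g) = shift a f - shift a g.
Proof. exact: comp_polyB. Qed.

Lemma shift0 f : shift 0 f = f.
Proof. by rewrite /shift addr0 comp_polyXr. Qed.

Lemma shiftX (a : K) : shift a 'X = 'X + a%:P.
Proof. by rewrite /shift comp_polyX. Qed.

Lemma polyfun_Wpoly n (a b c : int) :
  polyfun (fun m p => Wpoly n (a * m + b * p + c)).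
Proof.
rewrite (_ : (fun m p => _) = fun m p => (- 2^-1)%:P * (falling n
    + ((-1) ^+ n.+1)%:P * shift (a * m + b * p + (c + n%:Z))%:~R (falling n))).
  apply: polyfunM; first exact: polyfun_cst.
  apply: polyfunD; first exact: polyfun_cst.
  apply: polyfunM; first exact: polyfun_cst.
  by apply: (polyfun_shift (F := fun _ _ => falling n)); exact: polyfun_cst.
by apply/funext => m; apply/funext => p; rewrite /Wpoly !mul_polyC addrA.
Qed.

(* On the lines m + p = const the coefficients of the bracket are polynomials
   in m of bounded degree, and multiplication by z - w is a finite difference. *)
Lemma killed_W_bracket n n' :
  killed (fun m p => Dplus_bracket (W n (- m - n%:Z - 1)) (W n' (- p - n'%:Z - 1))
                     : Dplus K).
Proof.
(* The power of t in the bracket, (- m - n - 1) + (- p - n' - 1), depends only on s = m + p. So does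
   the condition under which the cocycle is nonzero, and [killed_family] removes both. *)
pose d (s : int) : int := - s - n%:Z - n'%:Z - 2.
pose L1 s f : Dhat K := (tD (d s) f, 0).
pose L2 s (y : K^o) : Dhat K := (0, if d s == 0 then y else 0).
have L1z s : zmod_morphism (L1 s).
  by move=> f g; rewrite /L1 linearB; congr (_, _); rewrite subr0.
have L2z s : zmod_morphism (L2 s).
  by move=> f g; rewrite /L2; congr (_, _); [rewrite subr0|case: ifP; rewrite ?subr0].
pose A1 s : {additive {poly K} -> Dhat K} :=
  HB.pack (L1 s) (GRing.isZmodMorphism.Build _ _ (L1 s) (L1z s)).
pose A2 s : {additive K^o -> Dhat K} :=
  HB.pack (L2 s) (GRing.isZmodMorphism.Build _ _ (L2 s) (L2z s)).
pose f m p := Wpoly n ((- 1) * m + 0 * p + (- n%:Z - 1)).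
pose g m p := Wpoly n' (0 * m + (- 1) * p + (- n'%:Z - 1)).
pose sl m p := shift (0 * m + (- 1) * p + (- n'%:Z - 1))%:~R (f m p).
pose sk m p := shift ((- 1) * m + 0 * p + (- n%:Z - 1))%:~R (g m p).
have pf : polyfun f by exact: polyfun_Wpoly.
have pg : polyfun g by exact: polyfun_Wpoly.
have psl : polyfun sl by exact: polyfun_shift.
have psk : polyfun sk by exact: polyfun_shift.
apply: (@killed_inj _ _ (val : {additive Dplus K -> Dhat K}) _ val_inj).
rewrite (_ : (fun m p => _) = fun m p => A1 (m + p) (sl m p * g m p + - (f m p * sk m p))
   + A2 (m + p) (discrete_sum (- n%:Z - 1 - m) (f m p * sk m p))).
  apply: killedD.
    apply/killed_family/polyfun_killed/polyfunD; first exact: polyfunM.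
    by apply: polyfunN; exact: polyfunM.
  by apply/killed_family/killed_discrete_sum; exact: polyfunM.
apply/funext => m; apply/funext => p.
rewrite /= /Dhat_bracket /= /L1 /L2 !W_opE Dbracket_tD Psi_tD Psi_monoE.
have -> : - m - n%:Z - 1 = - 1 * m + 0 * p + (- n%:Z - 1) by lia.
have -> : - p - n'%:Z - 1 = 0 * m + - 1 * p + (- n'%:Z - 1) by lia.
have -> : d (m + p) = - 1 * m + 0 * p + (- n%:Z - 1)
                      + (0 * m + - 1 * p + (- n'%:Z - 1)) by rewrite /d; lia.
have -> : - n%:Z - 1 - m = - 1 * m + 0 * p + (- n%:Z - 1) by lia.
by congr (_, _); rewrite ?addr0 ?add0r.
Qed.

(** Both sides are [falling n.+1], with the first or the last factor split off. *)
Lemma falling_shift n : 'X * shift (-1) (falling n) = ('X - n%:R%:P) * falling n.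
Proof.
elim: n => [|n IH]; first by rewrite /falling big_ord0 /shift comp_polyC subr0.
have -> : falling n.+1 = falling n * ('X - n%:R%:P) by rewrite /falling big_ord_recr.
rewrite shiftM mulrA IH shiftB shiftX [shift _ _%:P]comp_polyC.
by rewrite -(natr1 n) polyCD polyCN; ring.
Qed.

(** W^1_(-1) is - d_t; in terms of fields this is the covariance [T, W^n(z)] = d_z W^n(z). The
    identity reduces to [falling_shift] on both summands of [Wpoly]. *)
Lemma W_bracket_transl n k :
  Dplus_bracket (W 1 (- 1)) (W n k) = - (k + n%:Z)%:~R *: W n (k - 1) :> Dplus K.
Proof.
apply: val_inj. rewrite linearZ /= /Dhat_bracket /= !W_opE Dbracket_tD Psi_tD Psi_monoE.
have W1 : Wpoly 1 (- 1) = - 'X.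
  rewrite /Wpoly addNr shift0 /falling big_ord1 subr0 expr2 mulrNN mulr1 scale1r.
  by rewrite -mulr2n -scaler_nat scalerA mulNr mulVf ?pnatr_eq0 // scaleN1r.
have -> : - (k + n%:Z)%:~R *: Dhat_op (tD (k - 1) (Wpoly n (k - 1)))
    = (tD (k - 1) (- (k + n%:Z)%:~R *: Wpoly n (k - 1)), 0).
  by congr (_, _); [exact: esym (linearZ_LR (tD (k - 1)) _ _)|exact: scaler0].
congr (_, _); last first.
  (* For r = -1 the cocycle is a single term at j = 0, where the polynomial - X of W^1_(-1)
     vanishes. *)
  case: ifP => // _; rewrite (_ : - 1 = Negz 0) // /discrete_sum big_ord1 W1.
  by rewrite hornerM hornerN hornerX oppr0 mul0r oppr0.
rewrite [- 1 + k]addrC; congr (tD _ _).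
rewrite W1 rmorphN1 /Wpoly; set F := falling n; set x := (k + n%:Z)%:~R : K.
have -> : (k - 1 + n%:Z)%:~R = x - 1 :> K by rewrite /x !rmorphD rmorphN1 addrAC.
have kE : k%:~R = x - n%:R :> K by rewrite /x rmorphD /= addrK.
have sZ a (c : K) (f : {poly K}) : shift a (c *: f) = c *: shift a f by apply: comp_polyZ.
have sD a (f g : {poly K}) : shift a (f + g) = shift a f + shift a g by apply: comp_polyD.
rewrite !sZ !sD !sZ shiftA [- 1 + x]addrC kE -[- 'X]scaleN1r sZ shiftX !scaleN1r.
have H1 := falling_shift n; rewrite -/F in H1.
have H2 : ('X + x%:P) * shift (x - 1) F = ('X + (x - n%:R)%:P) * shift x F.
  have := f_equal (shift x) H1; rewrite !shiftM shiftX shiftB shiftX shiftA => ->.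
  by rewrite [shift _ _%:P]comp_polyC polyCB addrA.
rewrite -!mul_polyC; set a := (- 2^-1)%:P; set e := ((-1) ^+ n.+1)%:P.
set F1 := shift (-1) F in H1 *; set G' := shift (x - 1) F in H2 *.
set G := shift x F in H2 *.
rewrite polyCN polyCB in H2 *.
transitivity (a * ('X * F1 - ('X + x%:P - n%:R%:P) * F
                   + e * ('X * G' - ('X + (x%:P - n%:R%:P)) * G))); first by ring.
by rewrite H1 -H2; ring.
Qed.
End WOperators.

(** * Spanning by C and the W^n_k with n odd *)

Section Spanning.
Variable K : numFieldType.
Implicit Types (f g : {poly K}) (n : nat) (k : int).

(* [shift ((k + 1) / 2) g] with g odd, expressed as an antisymmetry of f. *)
Definition antisym k f : Prop := f \Po (- 'X - (k%:~R + 1)%:P) = - f.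

Lemma antisymZD k a f g : antisym k f -> antisym k g -> antisym k (a *: f + g).
Proof. by move=> kf kg; rewrite /antisym comp_polyD comp_polyZ kf kg scalerN opprD. Qed.

Lemma antisym_shift k g : oddp g -> antisym k (shift ((k%:~R + 1) / 2) g).
Proof.
move=> go; have cN (p q : {poly K}) : (- p) \Po q = - (p \Po q) by apply: linearN.
rewrite /antisym /shift -comp_polyA -cN -go -!comp_polyA; congr (_ \Po _).
rewrite cN !comp_polyD !comp_polyX comp_polyC opprD -addrA; congr (_ + _).
by rewrite -polyCN -polyCD -polyCN; congr (_%:P); field.
Qed.

Lemma antisym_coef (x : Dhat K) k : x \in span (@Dplus_gen K) -> antisym k x.1@_k.
Proof.
have antisym0 : antisym k 0 by rewrite /antisym comp_poly0 oppr0.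
move=> /spanP; elim=> [|a {}x y gx _ IH]; first by rewrite mcoeff0.
rewrite mcoeffD [X in X + _]DopZE; apply: antisymZD IH.
case: gx => [|l g go]; first by rewrite mcoeff0.
by rewrite mcoeffU; case: eqP => [->|_]; [exact: antisym_shift|exact: antisym0].
Qed.

(** The substitution multiplies the leading coefficient by (-1)^deg f, and antisymmetry by -1. *)
Lemma antisym_odd k f : antisym k f -> f != 0 -> odd (size f).-1.
Proof.
move=> kf f0; pose q : {poly K} := - 'X - (k%:~R + 1)%:P.
have q1 : - q = 'X - (- (k%:~R + 1))%:P by rewrite /q opprD !opprK polyCN opprK.
have sq : size q = 2 by rewrite -size_polyN q1 size_XsubC.
have lq : lead_coef q = -1 by rewrite -[q]opprK lead_coefN q1 lead_coefXsubC.
have := f_equal (@lead_coef K) kf; rewrite lead_coef_comp ?sq // lq lead_coefN.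
move/eqP; rewrite -signr_odd; case: odd => //; rewrite expr0 mulr1 -addr_eq0.
by rewrite -mulr2n mulrn_eq0 lead_coef_eq0 (negPf f0).
Qed.

Lemma falling_monic n : falling K n \is monic.
Proof. exact: monic_prod_XsubC. Qed.

Lemma size_falling n : size (falling K n) = n.+1.
Proof. by rewrite size_prod_XsubC /index_enum -enumT size_enum_ord. Qed.

(** For odd n the leading terms of the two summands add up instead of cancelling. *)
Lemma Wpoly_lead n k : odd n ->
  (size (Wpoly K n k) <= n.+1)%N /\ (Wpoly K n k)`_n = -1.
Proof.
move=> n_odd; pose F := shift (k + n%:Z)%:~R (falling K n).
have sF : size F = n.+1 by rewrite size_comp_poly2 ?size_falling // size_XaddC.
have lF : F`_n = 1.
  have -> : F`_n = lead_coef F by rewrite /lead_coef sF.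
  rewrite lead_coef_comp ?size_XaddC // lead_coefXaddC expr1n mulr1.
  exact/eqP/falling_monic.
have lf : (falling K n)`_n = 1.
  by have /eqP := falling_monic n; rewrite /lead_coef size_falling.
have WE : Wpoly K n k = - 2^-1 *: (falling K n + F).
  by rewrite /Wpoly -signr_odd /= n_odd scale1r.
rewrite WE; split.
  apply: leq_trans (size_scale_leq _ _) _; apply: leq_trans (size_polyD _ _) _.
  by rewrite size_falling sF maxnn.
by rewrite coefZ coefD lF lf mulNr mulVf // pnatr_eq0.
Qed.

Lemma Dhat_opZD a (x y : Dop K) : Dhat_op (a *: x + y) = a *: Dhat_op x + Dhat_op y.
Proof. by congr (_, _); rewrite [RHS]addr0; apply/esym/scaler0. Qed.

(** Triangularity in the degree: f has odd degree n, and adding [lead_coef f] times W^n_k, whose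
    leading coefficient is -1, lowers it. *)
Lemma span_homogeneous k f (x : Dplus K) : val x = Dhat_op (tD k f) ->
  x \in span (fun y => exists2 n, odd n & y = W n k).
Proof.
have [m] := ubnP (size f); elim: m f x => // m IH f x fm xE.
have kf : antisym k f.
  by have := antisym_coef k (valP x); rewrite xE mcoeffUU.
have [f0|f0] := eqVneq f 0.
  rewrite (_ : x = 0) ?rpred0 //; apply: val_inj.
  by rewrite xE f0 /Dhat_op linear0.
set n := (size f).-1; have n_odd : odd n := antisym_odd kf f0.
have sf : size f = n.+1 by rewrite prednK // size_poly_gt0.
have [sW lW] := Wpoly_lead k n_odd.
rewrite -[x](addrK (lead_coef f *: W n k)); apply: rpredB; last first.
  by apply/rpredZ/mem_span; exists n.
apply: (IH (f + lead_coef f *: Wpoly K n k)).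
  rewrite -ltnS; apply: leq_trans (_ : n.+1 < m.+1)%N; last by rewrite -sf.
  rewrite ltnS; apply/leq_sizeP => j; rewrite leq_eqVlt => /predU1P[<-|nj].
    by rewrite coefD coefZ lW mulrN1 /lead_coef subrr.
  rewrite coefD coefZ !nth_default ?mulr0 ?addr0 ?sf //; exact: leq_trans sW _.
rewrite addrC [f + _]addrC linearP /= xE /= W_opE -Dhat_opZD.
by congr Dhat_op; exact: esym (linearP (tD k) _ _ _).
Qed.

Lemma span_Dplus (x : Dplus K) :
  x \in span (fun y => y = Dplus_C K \/ exists n k, odd n /\ y = W n k).
Proof.
suff H z : in_span (@Dplus_gen K) z -> forall x : Dplus K, val x = z ->
    x \in span (fun y => y = Dplus_C K \/ exists n k, odd n /\ y = W n k).
  by apply: H (erefl _); apply/spanP/valP.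
elim=> {x} [x x0|a g y gg Sy IH x xE].
  by rewrite (_ : x = 0) ?rpred0 //; apply: val_inj.
have [g' g'E] : exists g' : Dplus K, val g' = g by exists (MkDplus (mem_span gg)).
have ySy : y \in span (@Dplus_gen K) by apply/spanP.
rewrite (_ : x = a *: g' + MkDplus ySy); last first.
  by apply: val_inj; rewrite linearP /= g'E.
apply: rpredD; last exact: IH.
apply: rpredZ; case: gg g'E => [|k h ho] g'E.
  by apply: mem_span; left; exact: val_inj.
have /spanP := span_homogeneous g'E; elim=> [|b u v [n n_odd ->] _ IHv].
  exact: rpred0.
by apply: rpredD IHv; apply/rpredZ/mem_span; right; exists n, k.
Qed.

Lemma W_bracket_homogeneous n k n' k' : k + k' != 0 ->
  Dplus_bracket (W n k) (W n' k') \in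
    span (fun y : Dplus K => exists2 m, odd m & y = W m (k + k')).
Proof.
move=> kk; have := @span_homogeneous (k + k') _ (Dplus_bracket (W n k) (W n' k')).
apply; rewrite /= /Dhat_bracket /= !W_opE Dbracket_tD Psi_tD Psi_monoE (negPf kk).
reflexivity.
Qed.
End Spanning.

(** * Modules generated by a vacuum vector *)

Section VacuumQuotient.
Variables (K : numFieldType) (c : K) (V : lmodType K) (rho : Dplus K -> V -> V).
Variable vac : V.
Implicit Types A B : distr V.
Hypothesis rho_module : lie_module Dplus_bracket rho.
Hypothesis rho_vac : forall x, PC x -> rho x vac = PC_char c x *: vac.
Hypothesis vac_generates : forall U : V -> Prop, U vac ->
  (forall a u v, U u -> U v -> U (a *: u + v)) ->
  (forall x u, U u -> U (rho x u)) -> forall v, U v.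

Let rho_linl v : linear (rho^~ v). Proof. by case: rho_module. Qed.
Let rho_linr x : linear (rho x). Proof. by case: rho_module. Qed.
Let rho_bracket x y v :
  rho (Dplus_bracket x y) v = rho x (rho y v) - rho y (rho x v).
Proof. by case: rho_module. Qed.

Let rhoL (v : V) : {linear Dplus K -> V} :=
  HB.pack (rho^~ v) (GRing.isLinear.Build _ _ _ _ (rho^~ v) (rho_linl v)).
Let rhoR (x : Dplus K) : {linear V -> V} :=
  HB.pack (rho x) (GRing.isLinear.Build _ _ _ _ (rho x) (rho_linr x)).

Let rho_comm x y v : rho x (rho y v) = rho (Dplus_bracket x y) v + rho y (rho x v).
Proof. by rewrite rho_bracket subrK. Qed.

Lemma rho_W_vac n k : odd n -> 0 <= n%:Z + k -> rho (W n k) vac = 0.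
Proof.
move=> n_odd nk; rewrite rho_vac; first by rewrite /PC_char mulr0 scale0r.
by apply: mem_span; constructor.
Qed.

Lemma rho_stable (U : submodClosed V) (S : V -> Prop) x v :
  (forall u, S u -> rho x u \in U) -> v \in span S -> rho x v \in U.
Proof.
move=> SU /spanP; elim=> [|a u w Su _ IH]; first by rewrite [rho _ _](linear0 (rhoR x)) rpred0.
by rewrite rho_linr; apply: rpredD IH; apply/rpredZ/SU.
Qed.

Lemma rho_span (U : submodClosed V) (S : Dplus K -> Prop) x v :
  (forall y, S y -> rho y v \in U) -> x \in span S -> rho x v \in U.
Proof.
move=> SU /spanP; elim=> [|a y z Sy _ IH]; first by rewrite [rho _ _](linear0 (rhoL v)) rpred0.
by rewrite rho_linl; apply: rpredD IH; apply/rpredZ/SU.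
Qed.

Definition bounded_monomial l v : Prop :=
  exists s, [/\ all (fun p => odd p.1) s, (size s <= l)%N & v = W_monomial rho vac s].

(** x is a combination of elements of [PC], which preserve the length by hypothesis, and of creation
    operators, which are prepended. The hypothesis is discharged by [rho_annihilation], which uses
    this lemma one level lower. *)
Lemma rho_bounded l : (forall x v, PC x ->
    v \in span (bounded_monomial l) -> rho x v \in span (bounded_monomial l)) ->
  forall x v, v \in span (bounded_monomial l) ->
    rho x v \in span (bounded_monomial l.+1).
Proof.
move=> IH x v vl.
have sub : {subset span (bounded_monomial l) <= span (bounded_monomial l.+1)}.
  apply: span_sub => u [s [s_odd sl ->]]; apply: mem_span.
  by exists s; split=> //; exact: leqW.
apply: rho_span (span_Dplus x) => y [->|[n [k [n_odd ->]]]].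
  by apply/sub/IH => //; apply: mem_span; constructor.
have [nk|nk] := lerP 0 (n%:Z + k).
  by apply/sub/IH => //; apply: mem_span; constructor.
apply: rho_stable vl => u [s [s_odd sl ->]]; apply: mem_span.
(* Since n + k < 0, the j with k = - j - n - 1 is |n + k| - 1. *)
exists ((n, `|n%:Z + k|.-1) :: s); rewrite /= n_odd; split=> //.
by congr (rho (W n _) _); lia.
Qed.

(** In x w u = [x, w] u + w x u with u of length l, the bracket raises the length of u by at most
    one; x preserves it and w then raises it by one. *)
Lemma rho_annihilation l x v : PC x ->
  v \in span (bounded_monomial l) -> rho x v \in span (bounded_monomial l).
Proof.
elim: l x v => [|l IH] x v px.
  apply: rho_stable => u [[|q s] [_ // _ ->]]; rewrite /= rho_vac //.
  by apply/rpredZ/mem_span; exists [::].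
apply: rho_stable => u [[|q s] [s_odd sl ->]].
  rewrite /= rho_vac //; apply/rpredZ/mem_span; by exists [::].
have sm : W_monomial rho vac s \in span (bounded_monomial l).
  by apply: mem_span; exists s; split=> //; case/andP: s_odd.
rewrite /= rho_comm; apply: rpredD; first exact: rho_bounded.
by apply: rho_bounded => //; exact: IH.
Qed.

Lemma monomials_span v :
  v \in span (fun u => exists2 s, all (fun p => odd p.1) s & u = W_monomial rho vac s).
Proof.
move: v; apply: vac_generates => [|a u v Su Sv|x u].
- by apply: mem_span; exists [::].
- by apply: rpredD => //; exact: rpredZ.
apply: rho_stable => w [s s_odd ->].
have : rho x (W_monomial rho vac s) \in span (bounded_monomial (size s).+1).
  apply: rho_bounded; first by move=> y z py; exact: rho_annihilation.
  by apply: mem_span; exists s.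
apply: span_sub => z [s' [s'_odd _ ->]].
by apply: mem_span; exists s'.
Qed.

(** The bound is uniform in n because [W^n_k, W^n'_k'] spreads over W^m_(k + k') with m
    uncontrolled. *)
Lemma rho_W_large v : exists N : int, forall n k, odd n -> N <= k -> rho (W n k) v = 0.
Proof.
have rho0 x : rho x 0 = 0 := linear0 (rhoR x).
move: v; apply: vac_generates => [|a u v [N uN] [M vM]|x u [N uN]].
- by exists 0 => n k n_odd k0; apply: rho_W_vac => //; lia.
- exists (Num.max N M) => n k n_odd; rewrite ge_max => /andP[Nk Mk].
  by rewrite rho_linr uN ?vM // scaler0 addr0.
have /spanP := span_Dplus x; elim=> [|a y z gy _ [M zM]].
  by exists 0 => n k _ _; rewrite [rho 0 u](linear0 (rhoL u)) rho0.
have [L yL] : exists L : int, forall n k, odd n -> L <= k -> rho (W n k) (rho y u) = 0.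
  case: gy => [->|[n' [k' [_ ->]]]].
    exists N => n k n_odd Nk; rewrite rho_comm uN // rho0 addr0.
    rewrite (_ : Dplus_bracket _ _ = 0) ?[rho 0 _](linear0 (rhoL u)) //.
    by apply: val_inj; exact: Dhat_bracketCr.
  (* The three bounds give k >= N, k + k' >= N for the modes in the bracket, and k + k' > 0, which
     excludes a central term. *)
  exists (Num.max N (Num.max (N - k') (1 - k'))) => n k n_odd.
  rewrite !ge_max => /and3P[Nk kN k1]; rewrite rho_comm uN // rho0 addr0.
  have kk : k + k' != 0 by lia.
  have /spanP := @W_bracket_homogeneous K n k n' k' kk.
  elim=> [|b w w' [m m_odd ->] _ IH]; first by rewrite [LHS](linear0 (rhoL u)).
  by rewrite [LHS]rho_linl IH uN ?scaler0 ?addr0 //; lia.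
exists (Num.max L M) => n k n_odd; rewrite ge_max => /andP[Lk Mk].
by rewrite rho_linl rho_linr yL ?zM // scaler0 addr0.
Qed.

Let T := rho (W 1 (- 1)).
Let T_linear : linear T := rho_linr _.

Lemma T_vac : T vac = 0.
Proof. exact: rho_W_vac. Qed.

Lemma W_field_state n : odd n -> state_field vac T (W_field rho n).
Proof.
move=> n_odd; split=> [m|v|m v|m m0].
- exact: rho_linr.
- have [N vN] := rho_W_large v; exists (- N - n%:Z) => m mN.
  by apply: vN => //; lia.
- rewrite /T /W_field -rho_bracket W_bracket_transl.
  rewrite [LHS](linearZ_LR (rhoL v)) /distr_deriv /W_field -rmorphN.
  by congr (_%:~R *: rho (W n _) v); lia.
- by apply: rho_W_vac => //; lia.
Qed.

Lemma W_field_local n n' : mutually_local (W_field rho n) (W_field rho n').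
Proof.
have [N killN] := killed_W_bracket K n n'.
apply/mutually_localP; exists N => v; apply/funext => m; apply/funext => p.
have := iter_dif_family (fun _ => rhoL v : {additive Dplus K -> V}) N
  (fun m p => Dplus_bracket (W n (- m - n%:Z - 1)) (W n' (- p - n'%:Z - 1))) m p.
rewrite killN raddf0 => H; apply: etrans H; congr (iter _ _ _ m p).
by apply/funext => k; apply/funext => l; rewrite /= rho_bracket.
Qed.

Lemma divderiv_state k A : state_field vac T A -> state_field vac T (distr_divderiv k A).
Proof.
move=> sA; rewrite (_ : distr_divderiv k A
    = (k`!%:R)^-1 *: (iter k (@distr_deriv K V) A : int -> V -> V) + 0).
  apply: (state_fieldZD T_linear); last exact: (state_field0 vac T_linear).
  by elim: k => //= k IH; exact: state_field_deriv.
by rewrite addr0.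
Qed.

Lemma divderiv_local k A B : end_distr B ->
  mutually_local A B -> mutually_local (distr_divderiv k A) B.
Proof.
move=> lB AB; rewrite (_ : distr_divderiv k A
    = (k`!%:R)^-1 *: (iter k (@distr_deriv K V) A : int -> V -> V) + 0).
  apply: mutually_localZD => //.
    by elim: k => //= k IH; exact: distr_deriv_local.
  exists 0%N => m n v; rewrite /distr_comm /=.
  by rewrite -[LHS]/(0 - B n 0) end_distr0 ?subr0.
by rewrite addr0.
Qed.

(** Taylor's formula; for A = W^n(z) the coefficient at k is W^n_(- k - n - 1), the mode that occurs
    in [W_monomial]. *)
Lemma divderiv_vac k A v : distr_divderiv k A 0 v = A k v.
Proof.
have e m : iter k (@distr_deriv K V) A m v
         = (\prod_(i < k) (m + i.+1%:Z))%:~R *: A (m + k%:Z) v.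
  elim: k m => [|k IH] m; first by rewrite big_ord0 scale1r addr0.
  rewrite iterS /distr_deriv IH scalerA -intrM big_ord_recl /=.
  rewrite (_ : m + 1 + k%:Z = m + k.+1%:Z); last lia.
  congr ((_ * _)%:~R *: _); apply: eq_bigr => i _; rewrite /bump /=; lia.
rewrite /distr_divderiv e add0r scalerA.
rewrite (_ : \prod_(i < k) _ = k`!%:Z); last first.
  rewrite fact_prod big_add1 big_mkord -[RHS]natz natr_prod.
  by apply: eq_bigr => i _; rewrite natz add0r.
by rewrite mulVf ?scale1r // pnatr_eq0 -lt0n fact_gt0.
Qed.

Lemma W_nprod_state s : all (fun p => odd p.1) s -> state_field vac T (W_nprod rho s).
Proof.
elim: s => [_|q s IH /= /andP[q_odd s_odd]].
  exact: (state_field_id vac T_linear).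
by apply: (state_field_nprod T_linear); [exact/divderiv_state/W_field_state|exact: IH].
Qed.

Lemma W_nprod_vac s : all (fun p => odd p.1) s ->
  W_nprod rho s 0 vac = W_monomial rho vac s.
Proof.
elim: s => [_|q s IH /= /andP[q_odd s_odd]]; first by rewrite /= /distr_id eqxx.
rewrite (nprod_vac0 (T := T)); last 2 first.
- exact/divderiv_state/W_field_state.
- exact: W_nprod_state.
by rewrite IH // divderiv_vac.
Qed.

Lemma id_local A : end_distr A -> mutually_local (@distr_id K V) A.
Proof.
move=> lA; exists 0%N => m n v; rewrite /distr_comm /distr_id /=.
by case: eqP => _; rewrite ?end_distr0 ?subrr.
Qed.

Lemma W_nprod_local s s' : all (fun p => odd p.1) s -> all (fun p => odd p.1) s' ->
  mutually_local (W_nprod rho s) (W_nprod rho s').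
Proof.
pose D (q : nat * nat) : distr V := distr_divderiv q.2 (W_field rho q.1).
have sD q : odd q.1 -> state_field vac T (D q).
  by move=> q_odd; exact/divderiv_state/W_field_state.
have DD q q' : odd q.1 -> odd q'.1 -> mutually_local (D q) (D q').
  move=> qo q'o; apply: divderiv_local; first exact: sf_end (sD _ q'o).
  apply/mutually_local_sym/divderiv_local; first exact: sf_end (W_field_state qo).
  exact: W_field_local.
have nprod_local_step q t B : odd q.1 -> all (fun p => odd p.1) t ->
    end_distr B -> mutually_local (D q) (W_nprod rho t) ->
    mutually_local (D q) B -> mutually_local (W_nprod rho t) B ->
    mutually_local (W_nprod rho (q :: t)) B.
  move=> qo /W_nprod_state st lB qt qB tB; apply: nprod_mutually_local => //.
  - exact: sf_end (sD _ qo).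
  - exact: sf_end st.
  - exact: sf_field (sD _ qo).
  - exact: sf_field st.
(* Dong's lemma for :A B: also asks that A and B be mutually local, so a single factor is first
   compared with every nested product. *)
have DW t : all (fun p => odd p.1) t ->
    forall q, odd q.1 -> mutually_local (D q) (W_nprod rho t).
  elim: t => [_|q' t IH /= /andP[q'o t_odd]] q q_odd; apply: mutually_local_sym.
    by apply: id_local; exact: sf_end (sD _ q_odd).
  apply: nprod_local_step => //.
  - exact: sf_end (sD _ q_odd).
  - exact: IH.
  - exact: DD.
  - by apply/mutually_local_sym/IH.
move=> + s'o; elim: s => [_|q s IH /= /andP[q_odd s_odd]].
  by apply: id_local; exact: sf_end (W_nprod_state s'o).
apply: nprod_local_step => //.
- exact: sf_end (W_nprod_state s'o).
- exact: DW.
- exact: DW.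
- exact: IH.
Qed.

Lemma vacuum_quotient_vertex_algebra :
  exists Y, unique (state_field_map rho vac) Y /\ vertex_algebra vac T Y.
Proof.
pose P A := exists2 s, all (fun p => odd p.1) s & A = W_nprod rho s.
have [|A [s so ->]|A B [s so ->] [s' s'o ->]|v|Y [Ylin YP Yva]] :=
    @reconstruction K V vac T T_linear T_vac P.
- by exists [::].
- exact: W_nprod_state.
- exact: W_nprod_local.
- have /spanP := monomials_span v; elim=> [|a u w [s so ->] _ IH].
    exact: in_span0.
  apply: in_spanZD => //; exists (W_nprod rho s); first by exists s.
  exact: W_nprod_vac.
exists Y; split=> //; split.
  by split=> // s so; rewrite -W_nprod_vac // YP //; exists s.
move=> Y' [Y'lin Y's]; apply/funext => v.
have /spanP := monomials_span v; elim=> [|a u w [s so ->] _ IH].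
  have Z0 (Z : V -> distr V) : linear Z -> Z 0 = 0.
    by move=> Zlin; have := Zlin (-1) 0 0; rewrite scaler0 addr0 scaleN1r addNr.
  by rewrite !Z0.
by rewrite Ylin Y'lin IH Y's // -W_nprod_vac // YP //; exists s.
Qed.
End VacuumQuotient.

Lemma induced_generated (K : fieldType) (g : lmodType K) (br : g -> g -> g)
    (p : g -> Prop) (chi : g -> K) (U : induced br p chi -> Prop) :
  U (ind_gen br p chi) -> (forall a u v, U u -> U v -> U (a *: u + v)) ->
  (forall x u, U u -> U (ind_act x u)) -> forall v, U v.
Proof.
move=> U1 UD Ux v; rewrite -[v]lreprK; move: (lrepr v) => m.
have Uw s : U (lproj _ (word s)).
  by elim: s => [|x s IH] //; rewrite -lmul_wordE -ind_actE; exact: Ux.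
rewrite [m]monalgE linear_sum /=; apply: (big_rec U) => [|s w _ IH].
  by rewrite -(addNr (ind_gen br p chi)) -scaleN1r; exact: (UD _ _ _ U1 U1).
rewrite (_ : << m@_s *g s >> = m@_s *: word s) ?linearZ; first exact: (UD _ _ _ (Uw s) IH).
by apply/malgP=> t; rewrite mcoeffZ !mcoeffU mulr_natr.
Qed.

Theorem theorem14p1 (R : realType) (c : R[i]) :
  (exists Y : Mc c -> distr (Mc c),
     unique (state_field_map (Mc_act c) (Mc_vac c)) Y /\
     vertex_algebra (Mc_vac c) (Mc_act c (W 1 (- 1))) Y) /\
  forall (V : lmodType R[i]) (rho : Dplus R[i] -> V -> V) (f : Mc c -> V),
    irreducible_quotient Dplus_bracket (Mc_act c) rho f ->
    exists Y : V -> distr V,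
      unique (state_field_map rho (f (Mc_vac c))) Y /\
      vertex_algebra (f (Mc_vac c)) (rho (W 1 (- 1))) Y.
Proof.
have Mvac x : PC x -> Mc_act c x (Mc_vac c) = PC_char c x *: Mc_vac c.
  exact: ind_act_gen.
have Mgen (U : Mc c -> Prop) : U (Mc_vac c) ->
    (forall a u v, U u -> U v -> U (a *: u + v)) ->
    (forall x u, U u -> U (Mc_act c x u)) -> forall v, U v.
  exact: induced_generated.
split.
  exact: (vacuum_quotient_vertex_algebra (ind_lie_module _ _ _) Mvac Mgen).
move=> V rho f [rho_module _ [fL fhom] fsurj].
have f0 : f 0 = 0.
  by have := fL (-1) 0 0; rewrite scaler0 addr0 scaleN1r addNr.
(* Generation is transferred by pulling U back along f, which is equivariant and surjective. *)
apply: (vacuum_quotient_vertex_algebra (c := c)) => // [x px|U U0 UD Ux v].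
  by rewrite -fhom Mvac //; have := fL (PC_char c x) (Mc_vac c) 0; rewrite f0 !addr0.
have [u <-] := fsurj v; move: u; apply: Mgen => // [a u w Uu Uw|x u Uu].
  by rewrite fL; exact: UD.
by rewrite fhom; exact: Ux.
Qed.
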